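(* Let $A$ be a finite arrangement of real hyperplanes in $\mathbb{C}^n$ with defining functions $f_h(z)=u_{h,0}+\sum_{i=1}^n u_{h,i}z_i$ ($h\in A$), let $\lambda_h>0$ for $h\in A$, and let $$P(z)=\log\Big(\prod_{h\in A}f_h(z)^{\lambda_h}\Big).$$ Let $t$ be a small parameter, and consider the deformation $F_t(z)=z-t\,\nabla P(z)$. The inverse map of $z\mapsto F_t(z)$ can be written $$G_t(z)=z+t\,\nabla Q_t(z),$$ where $Q_t(z)$ is the unique solution of the Cauchy problem for the Hamilton–Jacobi equation $$\frac{\partial Q_t(z)}{\partial t}=\frac12\langle\nabla Q_t,\nabla Q_t\rangle,\qquad Q_{t=0}(z)=P(z).$$
   Context: The hyperplane indexed by $h\in A$ is the zero set of $f_h$; the arrangement is real, meaning that all coefficients $u_{h,0},u_{h,1},\dots,u_{h,n}$ are real. The gradient $\nabla=(\partial/\partial z_1,\dots,\partial/\partial z_n)$ is with respect to $z$, and $\langle a,b\rangle=\sum_{i=1}^n a_ib_i$. Explicitly, $\nabla P(z)=\sum_{h\in A}\lambda_h u_h/f_h(z)$ with $u_h=(u_{h,1},\dots,u_{h,n})$, defined on the complement of the hyperplanes. *)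

(* Defs.v *)
From HB Require Import structures.
From mathcomp Require Import all_boot all_order all_algebra.
From mathcomp Require Import all_classical all_reals all_analysis.
From mathcomp Require Export complex.

Set Implicit Arguments.
Unset Strict Implicit.
Unset Printing Implicit Defensive.

Import Order.TTheory GRing.Theory Num.Theory.
Import numFieldNormedType.Exports.

Local Open Scope classical_set_scope.
Local Open Scope ring_scope.
Local Open Scope complex_scope.

(* The normed (hence topological) structure of R[i] over itself, so that
   [differentiable], ['D_v f] and [derive1] are complex differentiation. *)
HB.instance Definition _ (R : realType) := NormedModule.copy R[i] R[i]^o.

Section Defs.
Variables (R : realType) (n : nat).
Local Notation C := R[i].
Local Notation Cn := 'rV[C]_n.

Definition cexp (w : C) : C :=
  (expR (complex.Re w))%:C * (cos (complex.Im w) +i* sin (complex.Im w)).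

Definition bilin (a b : Cn) : C := \sum_(i < n) a 0 i * b 0 i.

Definition grad (f : Cn -> C) (z : Cn) : Cn :=
  \row_(i < n) 'D_(delta_mx 0 i) f z.

Section Arrangement.
Variables (A : finType) (u0 : A -> R) (u : A -> 'rV[R]_n) (lambda : A -> R).

Definition affine_form (h : A) (z : Cn) : C :=
  (u0 h)%:C + \sum_(i < n) (u h 0 i)%:C * z 0 i.

Definition arr_complement : set Cn :=
  [set z | forall h, affine_form h z != 0].

(* All the values at z of the multivalued function
   log (prod_h f_h ^ lambda_h), where f_h ^ lambda_h = exp (lambda_h log f_h):
   [l h] is a value of log (f_h z). *)
Definition log_master_values (z : Cn) : set C :=
  [set w | exists l : A -> C,
     (forall h, cexp (l h) = affine_form h z) /\
     cexp w = \prod_h cexp ((lambda h)%:C * l h)].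

(* A single-valued branch on D is a continuous selection of values. *)
Definition log_master_branch (D : set Cn) (P : Cn -> C) : Prop :=
  (forall z, D z -> log_master_values z (P z)) /\
  (forall z, D z -> {for z, continuous P}).

End Arrangement.

(* Functions of class C^2 in the complex sense on W (an open set); by Cauchy
   theory these are exactly the holomorphic functions on W. *)
Definition holo2 (V : normedModType C) (W : set V) (f : V -> C) : Prop :=
  forall p, W p ->
    differentiable f p /\
    forall v, differentiable ('D_v f) p /\
    forall w, {for p, continuous ('D_w ('D_v f))}.

(* Neighbourhoods of the initial slice {t = 0} over D. *)
Definition slice_nbhd (D : set Cn) (W : set (C * Cn)) : Prop :=
  open W /\ forall z, D z -> W (0, z).

Definition HJ_solution (D : set Cn) (P : Cn -> C)
    (W : set (C * Cn)) (Q : C -> Cn -> C) : Prop :=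
  [/\ holo2 W (fun p => Q p.1 p.2),
      forall t z, W (t, z) ->
        derive1 (fun s => Q s z) t
          = 2^-1 * bilin (grad (Q t) z) (grad (Q t) z)
    & forall z, D z -> Q 0 z = P z].

Definition deformF (P : Cn -> C) (t : C) (z : Cn) : Cn := z - t *: grad P z.

Definition deformG (Q : C -> Cn -> C) (t : C) (z : Cn) : Cn :=
  z + t *: grad (Q t) z.

(* F and G are mutually inverse, for each t, between the t-slices of U and
   those of W. *)
Definition slicewise_inverse (U W : set (C * Cn)) (F G : C -> Cn -> Cn) :
    Prop :=
  (forall t z, U (t, z) -> W (t, F t z) /\ G t (F t z) = z) /\
  (forall t w, W (t, w) -> U (t, G t w) /\ F t (G t w) = w).

End Defs.

(* Main.v *)
(* With g = grad P, a branch of log prod_h f_h^lambda_h differs locally from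
   sum_h lambda_h Log f_h by a continuous function with countably many values,
   so g = sum_h (lambda_h / f_h) u_h is locally Lipschitz of class C^1.  For
   small t the map F_t z = z - t g z is an expansive perturbation of the
   identity, and its inverse G_t is differentiable jointly in (t, w).  The method
   of characteristics gives Q_t(w) = P(G_t w) - (t/2) <g, g>(G_t w), for which
   grad Q_t = g o G_t and dQ_t/dt = <grad Q_t, grad Q_t>/2, whence
   w + t grad Q_t(w) = G_t w.  If Q' is another solution, then S = Q' - Q
   satisfies the linear transport equation dS/dt = <b, grad S> with
   b = (grad Q' + grad Q)/2 and S = 0 at t = 0, so S vanishes by Haar's maximum
   argument on real cones. *)
Require Import Defs.
From HB Require Import structures.
From mathcomp Require Import all_boot all_order all_algebra.
From mathcomp Require Import all_classical all_reals all_analysis.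
From mathcomp Require Import complex lra ring.

Import Order.TTheory GRing.Theory Num.Theory.
Import numFieldNormedType.Exports.

Set Implicit Arguments.
Unset Strict Implicit.
Unset Printing Implicit Defensive.

Local Open Scope classical_set_scope.
Local Open Scope ring_scope.


(** Norms over [R[i]] are elements of [R[i]], whose order is only partial; [nr] moves every estimate
    to [R]. In general neither [g] nor its Lipschitz constant is bounded on [D], since both blow up
    near the hyperplanes, so how small [t] must be depends on [z]: the maps live on open sets of
    pairs [(t, z)], and injectivity on each slice has to be built into the domain. A single
    fixed-point argument serves three times: for the inverse of [F_t], for the linear operator
    [1 - t dg] whose inverse gives the derivative of [G_t], and for a local logarithm. The real
    exponents [lambda_h] decide how branches are compared: the periods form a countable subgroup of
    the imaginary axis that can be dense, so a continuous difference of branches is constant not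
    because its values are isolated but because they cannot fill an interval. For uniqueness the
    complex time [t] is fixed and only a real [s] varies in [s t]; a maximum argument there replaces
    integration of the field [b]. *)

(** * Real-valued norms *)

(* Locked, because [lra] otherwise unfolds it when it compares atoms. *)
HB.lock Definition nr (R : realType) (V : normedModType R[i]) (x : V) : R :=
  complex.Re `|x|.

Section RealNorm.
Variable R : realType.
Local Notation C := R[i].
Implicit Types V W : normedModType C.

Lemma nrE V (x : V) : `|x| = ((nr x)%:C)%C.
Proof. by rewrite !nr.unlock RRe_real // ger0_real. Qed.

Lemma nr_ge0 V (x : V) : 0 <= nr x.
Proof. by rewrite -ler0c -nrE. Qed.

Lemma nr0 V : nr (0 : V) = 0.
Proof. by rewrite !nr.unlock normr0. Qed.

Lemma nr_eq0 V (x : V) : nr x = 0 -> x = 0.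
Proof. by move=> h; apply/eqP; rewrite -normr_eq0 nrE h. Qed.

Lemma nrD V (x y : V) : nr (x + y) <= nr x + nr y.
Proof. by rewrite -lecR -nrE rmorphD /= -!nrE ler_normD. Qed.

Lemma nrN V (x : V) : nr (- x) = nr x.
Proof. by rewrite !nr.unlock normrN. Qed.

Lemma nrBC V (x y : V) : nr (x - y) = nr (y - x).
Proof. by rewrite -nrN opprB. Qed.

Lemma nrB V (x y : V) : nr (x - y) <= nr x + nr y.
Proof. by rewrite -(nrN y) nrD. Qed.

Lemma nr_triangle V (x y z : V) : nr (x - z) <= nr (x - y) + nr (y - z).
Proof. by rewrite -[x - z](subrKA y) nrD. Qed.

Lemma nrZ V (a : C) (x : V) : nr (a *: x) = nr a * nr x.
Proof. by apply: complexI; rewrite -nrE normrZ rmorphM /= -!nrE. Qed.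

Lemma nrM (a b : C) : nr (a * b) = nr a * nr b.
Proof. by apply: complexI; rewrite -nrE normrM rmorphM /= -!nrE. Qed.

Lemma nr_real (x : R) : nr (x%:C)%C = `|x|.
Proof. by rewrite !nr.unlock normc_def /= expr0n addr0 sqrtr_sqr. Qed.

Lemma nrV (a : C) : nr a^-1 = (nr a)^-1.
Proof. by apply: complexI; rewrite -nrE normfV fmorphV /= -!nrE. Qed.

Lemma nr_gt0 V (x : V) : (0 < nr x) = (x != 0).
Proof.
rewrite lt0r nr_ge0 andbT; congr (~~ _).
by apply/eqP/eqP => [/nr_eq0|->]; rewrite ?nr0.
Qed.

Lemma nr_coord n (v : 'rV[C]_n) i : nr (v 0 i) <= nr v.
Proof.
rewrite -lecR -!nrE.
have -> : `|v| = mx_norm v by [].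
rewrite mx_normE.
rewrite -[leLHS]nngE.
rewrite num_le.
exact: (le_bigmax _ (fun ij : 'I_1 * 'I_n => `|v ij.1 ij.2|%:nng) (0, i)).
Qed.

Lemma nr_rV_le n (v : 'rV[C]_n) c :
  0 <= c -> (forall i, nr (v 0 i) <= c) -> nr v <= c.
Proof.
move=> c0 vc; rewrite -lecR -!nrE.
have -> : `|v| = mx_norm v by [].
rewrite mx_normE.
have c0' : 0 <= (c%:C)%C by rewrite ler0c.
rewrite -[leRHS]/((NngNum c0')%:num) num_le; apply/bigmax_leP; split=> [|[i j] _].
  by rewrite -num_le /=.
by rewrite -num_le /= ord1 nrE lecR.
Qed.

Lemma nr_pair V W (p : V * W) : nr p = Num.max (nr p.1) (nr p.2).
Proof.
apply: complexI; rewrite -nrE prod_normE !nrE.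
by rewrite /Order.max ltcR; case: ifP.
Qed.

Lemma near_nrP V (x : V) (P : V -> Prop) :
  (\forall y \near x, P y) <->
  exists2 d : R, 0 < d & forall y, nr (y - x) < d -> P y.
Proof.
split=> [/nbhs_normP[d /= d0 h]|[d d0 h]].
  have dE : d = ((complex.Re d)%:C)%C by rewrite RRe_real // gtr0_real.
  exists (complex.Re d); first by rewrite -ltcR -dE.
  by move=> y yx; apply: h; rewrite /ball_ /= distrC nrE dE ltcR.
apply/nbhs_normP; exists (d%:C)%C; first by rewrite /= ltcR.
by move=> y; rewrite /ball_ /= distrC nrE ltcR => /h.
Qed.

Lemma near_nr_lt V (x : V) d : 0 < d -> \forall y \near x, nr (y - x) < d.
Proof. by move=> d0; apply/near_nrP; exists d. Qed.

Lemma cvg_nrP V (T : Type) (F : set_system T) (FF : Filter F) (f : T -> V) l :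
  f @ F --> l <-> forall e : R, 0 < e -> \forall t \near F, nr (f t - l) <= e.
Proof.
split=> [/cvgrPdist_le h e e0|h].
  have := h (e%:C)%C; rewrite ltcR => /(_ e0); apply: filterS => t.
  by rewrite distrC nrE lecR.
apply/cvgrPdist_le => e e0; have eE : e = ((complex.Re e)%:C)%C by rewrite RRe_real // gtr0_real.
have := h (complex.Re e); rewrite -ltcR -eE => /(_ e0); apply: filterS => t.
by rewrite distrC nrE eE lecR.
Qed.

Lemma continuous_nrP V W (f : V -> W) p : {for p, continuous f} <->
  forall e : R, 0 < e -> \forall q \near p, nr (f q - f p) <= e.
Proof. exact: cvg_nrP. Qed.

(** A first-order expansion determines the differential, so an explicit candidate [L] with a
    little-o remainder is enough. Every differential computed by hand below enters through this
    criterion. *)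
Lemma diff_nrP V W (f : V -> W) (L : {linear V -> W}) p : continuous L ->
  (forall e : R, 0 < e ->
    \forall q \near p, nr (f q - f p - L (q - p)) <= e * nr (q - p)) ->
  is_diff p f L.
Proof.
move=> cL h.
have H : f \o shift p = cst (f p) + L +o_ 0 id.
  apply/eqaddoP => e e0.
  have eE : e = ((complex.Re e)%:C)%C by rewrite RRe_real // gtr0_real.
  have := h (complex.Re e); rewrite -ltcR -eE => /(_ e0) /near_nrP[d d0 hd].
  apply/near_nrP; exists d => // y; rewrite subr0 => yd.
  have := hd (y + p); rewrite addrK => /(_ yd).
  by rewrite !nrE eE -rmorphM /= lecR !fctE /= opprD addrA.
have dL := diff_unique cL H.
split => //; apply/diff_locallyP; split; first by rewrite dL.
by rewrite dL.
Qed.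

Lemma diff_nr V W (f : V -> W) p : differentiable f p ->
  forall e : R, 0 < e ->
    \forall q \near p, nr (f q - f p - 'd f p (q - p)) <= e * nr (q - p).
Proof.
move=> /diff_locallyP[_ /eqaddoP H] e e0.
have := H (e%:C)%C; rewrite ltcR => /(_ e0) /near_nrP[d d0 hd].
apply/near_nrP; exists d => // y yd; have := hd (y - p); rewrite subr0 => /(_ yd).
by rewrite /= !nrE -rmorphM lecR !fctE /= subrK opprD addrA.
Qed.

Lemma linear_nr V W (L : {linear V -> W}) : continuous L ->
  exists2 K : R, 0 <= K & forall v, nr (L v) <= K * nr v.
Proof.
move=> /linear_lipschitz[k k0 h].
have kE : k = ((complex.Re k)%:C)%C by rewrite RRe_real // gtr0_real.
exists (complex.Re k); first by rewrite -ler0c -kE ltW.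
by move=> v; rewrite -lecR rmorphM /= -!nrE -kE.
Qed.

Lemma linear_nr_continuous V W (L : {linear V -> W}) (K : R) :
  (forall v, nr (L v) <= K * nr v) -> continuous L.
Proof.
move=> h x; apply/continuous_nrP => e e0.
apply/near_nrP; exists (e / (`|K| + 1)); first by rewrite divr_gt0 // ltr_wpDl.
move=> y yd; rewrite -linearB; apply: (le_trans (h _)).
apply: (@le_trans _ _ ((`|K| + 1) * nr (y - x))).
  by rewrite ler_wpM2r ?nr_ge0 // (le_trans (ler_norm _)) // lerDl.
by rewrite mulrC -ler_pdivlMr ?ltW // ltr_wpDl.
Qed.

Lemma nr_continuous V : continuous (@nr R V).
Proof.
move=> w; apply/cvgrPdist_le => e e0.
have := near_nr_lt w e0; apply: filterS => y yw.
rewrite distrC ler_norml; apply/andP; split.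
  by have := nr_triangle w y 0; rewrite !subr0 nrBC; lra.
by have := nr_triangle y w 0; rewrite !subr0; lra.
Qed.

Lemma nr_sub_continuous V (z : V) : continuous (fun x => nr (x - z)).
Proof.
move=> w; apply: (@continuous_comp _ _ _ (fun x => x - z)); last exact: nr_continuous.
apply/continuous_nrP => e e0; have := near_nr_lt w e0; apply: filterS => y /ltW.
by rewrite opprB addrA subrK.
Qed.

Lemma nr_ReIm (w : C) : `|complex.Re w| <= nr w /\ `|complex.Im w| <= nr w.
Proof.
by case: w => a b; rewrite nr.unlock normc_def /=; split;
  rewrite -sqrtr_sqr ler_wsqrtr // ?lerDl ?lerDr sqr_ge0.
Qed.

Lemma nr_le_ReIm (w : C) : nr w <= `|complex.Re w| + `|complex.Im w|.
Proof.
case: w => a b /=; have -> : (a +i* b)%C = (a%:C + 'i * b%:C)%C by simpc.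
apply: (le_trans (nrD _ _)); rewrite nrM !nr_real.
have -> : nr ('i%C : C) = 1.
  by rewrite nr.unlock normc_def /= expr0n add0r expr1n sqrtr1.
by rewrite mul1r.
Qed.

(** The disc is a closed subset of the image of the square [[-r, r] x [-r, r]] under
    [(a, b) |-> a + i b]. *)
Lemma complex_box_compact (r : R) : compact [set w : C | nr w <= r].
Proof.
pose f (p : R * R) : C := (p.1 +i* p.2)%C.
have cf : continuous f.
  move=> p; apply/cvg_nrP => e e0.
  have e2 : 0 < e / 2 by rewrite divr_gt0.
  have : \forall q \near p, ball p (e / 2) q by exact: nbhsx_ballx.
  apply: filterS => q []; rewrite /ball /= => h1 h2.
  rewrite [e]splitr; apply: (le_trans (nr_le_ReIm _)); rewrite distrC (distrC q.2).
  exact: lerD (ltW h1) (ltW h2).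
have : compact (f @` (`[-r, r] `*` `[-r, r])).
  apply: continuous_compact; first exact: continuous_subspaceT.
  by apply: compact_setX; exact: segment_compact.
move=> cB; apply: (subclosed_compact _ cB).
  rewrite (_ : mkset _ = (@nr R C) @^-1` [set x : R | x <= r]) //.
  apply: preimage_closed; last exact: closed_le.
  by move=> w _; exact: nr_continuous.
move=> [a b] hw; exists (a, b) => //=.
have : 0 <= r by exact: le_trans (nr_ge0 _) hw.
move: hw; rewrite /= !nr.unlock normc_def /= => hw r0.
by split; rewrite /= in_itv /= -ler_norml -sqrtr_sqr (le_trans _ hw) // ler_wsqrtr // ?lerDl ?lerDr sqr_ge0.
Qed.

(** The ball is closed in a product of discs of radius [nr z + r]. This is the instance of the
    hypothesis [compact_balls] under which the inverse map and the transport equation are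
    treated. *)
Lemma closed_ball_compact n (z : 'rV[C]_n) (r : R) :
  compact [set x | nr (x - z) <= r].
Proof.
have [r0|r0] := ltP r 0.
  rewrite (_ : mkset _ = set0); first exact: compact0.
  by apply/seteqP; split => // x /= /(le_trans (nr_ge0 _)); rewrite leNgt r0.
have h : compact [set v : 'rV[C]_n | forall i, nr (v 0 i) <= nr z + r].
  have := @rV_compact C n (fun=> [set w : C | nr w <= nr z + r]).
  by apply => i; exact: complex_box_compact.
apply: (subclosed_compact _ h).
  rewrite (_ : mkset _ = (fun x => nr (x - z)) @^-1` [set x : R | x <= r]) //.
  apply: preimage_closed; last exact: closed_le.
  by move=> w _; exact: nr_sub_continuous.
move=> x /= xr i; apply: (le_trans (nr_coord _ _)).
by rewrite -[x](subrK z) addrC (le_trans (nrD _ _)) // lerD2l.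
Qed.

End RealNorm.

(* Norms are generalized first: comparing them as atoms up to conversion can
   make a bare [lra] very slow. *)
Ltac nr_lra :=
  (repeat match goal with
   | H : is_true (_ <= _) |- _ => revert H
   | H : is_true (_ < _) |- _ => revert H
   end;
   repeat match goal with
   | |- context [@nr ?R ?V ?x] => generalize (@nr R V x); intro
   end; intros; lra) || lra.


(** * Uniqueness for transport equations *)

Section TransportUniqueness.
Variables (R : realType) (E : normedModType R[i]).
Local Notation C := R[i].
Hypothesis compact_balls : forall (z : E) r, compact [set x | nr (x - z) <= r].
Implicit Types (S : C * E -> C).

(* Haar's argument: at a positive maximum of [nr S - e s] over the real cone of
   all points [(s t, z)] with [0 <= s <= 1] and [nr (z - w) <= M nr t (1 - s)],
   a small step along [t (-1, b)] stays in the cone, leaves [S] unchanged to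
   first order and increases the function. *)
Lemma transport_unique S (z0 : E) (M : R) :
  0 <= M ->
  (\forall p \near (0 : C, z0), differentiable S p) ->
  (\forall p \near (0 : C, z0), exists2 b : E, nr b <= M & 'd S p (-1, b) = 0) ->
  (\forall z \near z0, S (0, z) = 0) ->
  \forall p \near (0 : C, z0), S p = 0.
Proof.
move=> M0 /near_nrP[d1 d10 dS] /near_nrP[d2 d20 hb] /near_nrP[d3 d30 S0].
have [d [d0 dd1 dd2 dd3]] : exists d : R, [/\ 0 < d, d <= d1, d <= d2 & d <= d3].
  exists (Num.min d1 (Num.min d2 d3)); split.
  - by rewrite !lt_min d10 d20.
  - by rewrite ge_min lexx.
  - by rewrite !ge_min lexx orbT.
  - by rewrite !ge_min lexx !orbT.
(* With [rho (M + 1) = d / 2], a cone of height [nr t < rho] and slope [M] over a point [w] within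
   [rho] of [z0] stays in the ball of radius [d], where all three hypotheses hold. *)
pose rho := d / (2 * (M + 1)).
have M1 : 0 < M + 1 by rewrite ltr_wpDl.
have rho0 : 0 < rho by rewrite divr_gt0 // mulr_gt0.
have rhoM : rho * M + rho = d / 2.
  by rewrite /rho; field; rewrite gt_eqF.
have rhoMge : 0 <= rho * M by rewrite mulr_ge0 // ltW.
apply/near_nrP; exists rho => // -[t w]; rewrite nr_pair /= subr0 gt_max => /andP[tr wr].
(* The apex [s = 1] is the point [(t, w)] under study; the base [s = 0] lies in the initial slice,
   where [S] vanishes. *)
pose K : set (R * E) := [set q | [/\ 0 <= q.1, q.1 <= 1 & nr (q.2 - w) <= M * nr t * (1 - q.1)]].
pose pt (q : R * E) : C * E := ((q.1%:C)%C * t, q.2).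
have tM : nr t * M <= rho * M by rewrite ler_wpM2r // ltW.
have ptK q : K q -> nr (pt q - (0, z0)) < d.
  move=> [q0 q1 qw]; rewrite nr_pair /= subr0 gt_max nrM nr_real ger0_norm //.
  have t1 : q.1 * nr t <= 1 * nr t by rewrite ler_wpM2r ?nr_ge0.
  have := nr_triangle q.2 w z0.
  have : M * nr t * (1 - q.1) <= M * nr t * 1.
    by rewrite ler_wpM2l ?mulr_ge0 ?nr_ge0 //; nr_lra.
  by move=> ? ?; apply/andP; split; nr_lra.
have cpt : continuous pt.
  move=> q; apply: (@cvg_pair _ _ _ _ (nbhs ((q.1%:C)%C * t)) (nbhs q.2)); last exact: cvg_snd.
  apply: (@continuous_comp _ _ _ (fun q : R * E => q.1) (fun s : R => (s%:C)%C * t)).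
    exact: cvg_fst.
  apply/cvg_nrP => e e0.
  have e' : 0 < e / (nr t + 1) by rewrite divr_gt0 // ltr_wpDl ?nr_ge0.
  have : \forall s \near q.1, ball q.1 (e / (nr t + 1)) s by exact: nbhsx_ballx.
  apply: filterS => s; rewrite /ball /= -mulrBl -rmorphB nrM nr_real (distrC s).
  move=> /ltW h; apply: (@le_trans _ _ (`|q.1 - s| * (nr t + 1))).
    by rewrite ler_wpM2l // lerDl.
  by rewrite -ler_pdivlMr // ltr_wpDl ?nr_ge0.
have cK : compact K.
  have h : compact (`[0 : R, 1] `*` [set z : E | nr (z - w) <= M * nr t]).
    by apply: compact_setX; [exact: segment_compact|exact: compact_balls].
  apply: (subclosed_compact _ h).
    have -> : K = (fun q : R * E => q.1) @^-1` [set x | 0 <= x] `&`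
        ((fun q : R * E => q.1) @^-1` [set x | x <= 1] `&`
        (fun q : R * E => nr (q.2 - w) - M * nr t * (1 - q.1)) @^-1` [set x | x <= 0]).
      apply/seteqP; split => q /=.
        by case=> ? ? ?; split => //; split => //; rewrite subr_le0.
      by case=> ? [? ?]; split => //; rewrite -subr_le0.
    apply: closedI.
      by apply: preimage_closed; [move=> q _; exact: cvg_fst|exact: closed_ge].
    apply: closedI.
      by apply: preimage_closed; [move=> q _; exact: cvg_fst|exact: closed_le].
    apply: preimage_closed; last exact: closed_le.
    move=> q _; apply: cvgB.
      apply: (@continuous_comp _ _ _ (fun q : R * E => q.2) (fun z => nr (z - w))).
        exact: cvg_snd.
      exact: nr_sub_continuous.
    apply: cvgM; first exact: cvg_cst.
    by apply: cvgB; [exact: cvg_cst|exact: cvg_fst].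
  move=> q [q0 q1 qw]; split => /=; first by rewrite in_itv /= q0.
  apply: (le_trans qw); rewrite -[leRHS]mulr1 ler_wpM2l ?mulr_ge0 ?nr_ge0 //; nr_lra.
have Kw : K (1, w) by split => //=; rewrite subrr nr0 subrr mulr0.
suff H e : 0 < e -> nr (S (t, w)) <= e.
  apply: nr_eq0; apply/eqP; rewrite eq_le nr_ge0 andbT.
  by apply/ler_addgt0Pl => e e0; rewrite addr0 H.
move=> e0.
pose phi (q : R * E) : R := nr (S (pt q)) - e * q.1.
have K0 : K !=set0 by exists (1, w).
have cphi : {within K, continuous phi}.
  apply: continuous_in_subspaceT => q; rewrite inE => Kq.
  apply: cvgB; last by apply: cvgM; [exact: cvg_cst|exact: cvg_fst].
  apply: (@continuous_comp _ _ _ (S \o pt)); last exact: nr_continuous.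
  apply: continuous_comp; first exact: cpt.
  by apply: differentiable_continuous; apply: dS; apply: lt_le_trans (ptK _ Kq) dd1.
have [q qK qmax] := compact_EVT_max K0 cK cphi.
rewrite inE in qK.
suff phiq : phi q <= 0.
  have ptw : pt (1, w) = (t, w) by rewrite /pt mul1r.
  have := qmax (1, w); rewrite inE => /(_ Kw) /le_trans /(_ phiq).
  by rewrite /phi ptw mulr1 subr_le0.
have [q0|q0] := eqVneq q.1 0.
  have := ptK _ qK; rewrite /phi /pt q0 mul0r mulr0 nr_pair /= gt_max => /andP[_ h].
  by rewrite S0 ?nr0 ?subrr // (lt_le_trans h).
have {}q0 : 0 < q.1 by case: qK => + _ _; rewrite le_eqVlt eq_sym (negPf q0).
rewrite leNgt; apply/negP => phi0.
have ptq := ptK _ qK.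
have [b bM Sb] := hb (pt q) (lt_le_trans ptq dd2).
(* A step of length [s] along [t (-1, b)] moves the point by at most [s N]. Precision [e / (2 N)] in
   the expansion of [S] then costs at most [e s / 2], while the penalty [- e q.1] gains [e s]. The
   added 1 keeps [N] positive. *)
pose N := nr t * nr ((-1, b) : C * E) + 1.
have N0 : 0 < N by rewrite ltr_wpDl // mulr_ge0 ?nr_ge0.
have eN : 0 < e / (2 * N) by rewrite divr_gt0 // mulr_gt0.
have /near_nrP[k k0 hk] := diff_nr (dS _ (lt_le_trans ptq dd1)) eN.
pose s := Num.min q.1 (k / (2 * N)).
have s0 : 0 < s by rewrite lt_min q0 divr_gt0 // mulr_gt0.
have sq : s <= q.1 by rewrite ge_min lexx.
have sk : s * N < k.
  apply: (@le_lt_trans _ _ (k / (2 * N) * N)).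
    by apply: ler_wpM2r; [exact: ltW|rewrite ge_min lexx orbT].
  by rewrite invfM -mulrA -mulrA mulVf ?gt_eqF // mulr1; nr_lra.
pose q' : R * E := (q.1 - s, q.2 + ((s%:C)%C * t) *: b).
have ptq' : pt q' - pt q = ((s%:C)%C * t) *: ((-1, b) : C * E).
  rewrite /pt /q' /=; congr pair => /=; last by rewrite addrC addKr.
  by rewrite rmorphB /= mulrBl; rewrite /GRing.scale /=; ring.
have nq' : nr (pt q' - pt q) <= s * N.
  rewrite ptq' nrZ nrM nr_real gtr0_norm // -mulrA ler_wpM2l ?ltW // /N; nr_lra.
have Kq' : K q'.
  case: qK => ? ? qw; split => /=; [nr_lra|nr_lra|].
  have -> : q.2 + ((s%:C)%C * t) *: b - w = (q.2 - w) + ((s%:C)%C * t) *: b by rewrite addrAC.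
  apply: (le_trans (nrD _ _)); rewrite nrZ nrM nr_real gtr0_norm //.
  have : s * nr t * nr b <= s * nr t * M by rewrite ler_wpM2l // mulr_ge0 ?nr_ge0 // ltW.
  move: qw; set A := nr _; set B := nr t; set D := nr b; nra.
have := hk _ (le_lt_trans nq' sk).
rewrite {1}ptq' linearZ /= Sb scaler0 subr0.
have := qmax q'; rewrite inE => /(_ Kq'); rewrite /phi /=.
have : e / (2 * N) * nr (pt q' - pt q) <= e * s / 2.
  have -> : e * s / 2 = e / (2 * N) * (s * N) by field; rewrite gt_eqF.
  by rewrite ler_wpM2l // ltW.
have := nr_triangle (S (pt q)) (S (pt q')) 0; rewrite !subr0 nrBC.
have : 0 < e * s by rewrite mulr_gt0.
nr_lra.
Qed.

End TransportUniqueness.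


(** * The inverse of z - t g(z) *)

Lemma subrBB (V : zmodType) (x y z t : V) : x - y - (z - t) = (x - z) - (y - t).
Proof. by rewrite !opprB [LHS]addrACA [RHS]addrACA [- y + _]addrC. Qed.

Lemma subr_expansion (V : zmodType) (z d p q r s : V) :
  z - d - (z - (p - s) + (q - s)) = p - r - (q - s) + (r - s - d).
Proof.
have -> : z - (p - s) + (q - s) = z + (q - p).
  by rewrite -addrA; congr (_ + _); rewrite opprB addrC addrA subrK.
by rewrite subrBB [RHS]addrA subrK opprD opprB addrACA subrr add0r addrC.
Qed.

Lemma subrBZ (R : pzRingType) (V : lmodType R) (t : R) (x y a b : V) :
  x - t *: a - (y - t *: b) = (x - y) - t *: (a - b).
Proof. by rewrite scalerBr subrBB. Qed.

(** Testing the expansion at [p + s v] with [s] small leaves an error [e nr v] for arbitrary [e].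
    This turns the Lipschitz constant of a [lip_ball] into the operator bound needed to invert
    [1 - t dg]. *)
Lemma diff_bound (R : realType) (V W : normedModType R[i]) (f : V -> W) p (K : R) :
  differentiable f p ->
  (\forall q \near p, nr (f q - f p) <= K * nr (q - p)) ->
  forall v, nr ('d f p v) <= K * nr v.
Proof.
move=> df lf v; have [->|v0] := eqVneq v 0; first by rewrite linear0 !nr0 mulr0.
have nv0 : 0 < nr v by rewrite nr_gt0.
suff h e : 0 < e -> nr ('d f p v) <= K * nr v + e * nr v.
  apply/ler_addgt0Pl => e e0; have e1 : 0 < e / nr v by rewrite divr_gt0.
  by have := h _ e1; rewrite divfK ?gt_eqF // addrC.
move=> e0; have /near_nrP[d1 d10 h1] := diff_nr df e0.
have /near_nrP[d2 d20 h2] := lf.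
pose s := Num.min d1 d2 / (2 * nr v).
have m0 : 0 < Num.min d1 d2 by rewrite lt_min d10.
have s0 : 0 < s by rewrite divr_gt0 // mulr_gt0.
have sv : s * nr v < Num.min d1 d2.
  by rewrite /s invfM mulrA divfK ?gt_eqF // ltr_pdivrMr // mulr_natr mulr2n ltrDl.
pose q := (s%:C)%C *: v + p.
have qp : q - p = (s%:C)%C *: v by rewrite addrK.
have nq : nr (q - p) = s * nr v by rewrite qp nrZ nr_real gtr0_norm.
move: sv; rewrite lt_min -nq => /andP[/h1 + /h2].
rewrite nq {1}qp linearZ /= => a1 a2.
rewrite -(ler_pM2l s0) mulrDr; rewrite !(mulrCA s).
have -> : s * nr ('d f p v) = nr ((s%:C)%C *: 'd f p v) by rewrite nrZ nr_real gtr0_norm.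
rewrite -[(s%:C)%C *: _](subKr (f q - f p)).
exact: le_trans (nrB _ _) (lerD a2 a1).
Qed.

Section InverseMap.
Variables (R : realType) (E : normedModType R[i]).
Local Notation C := R[i].
Hypothesis compact_balls : forall (z : E) r, compact [set x | nr (x - z) <= r].
Variables (D : set E) (g : E -> E).

Definition lip_ball (z : E) (r K : R) : Prop :=
  [/\ 0 < r, 0 <= K, (forall x, nr (x - z) < r -> D x) &
    forall x y, nr (x - z) < r -> nr (y - z) < r ->
      nr (g x - g y) <= K * nr (x - y)].

Definition shift_map (t : C) (z : E) : E := z - t *: g z.

(* The bound on [t g z] by a quarter of the radius forces two points of the
   domain with the same image to lie in a common Lipschitz ball. *)
Definition shift_dom : set (C * E) :=
  [set p | exists r K, [/\ lip_ball p.2 r K, nr p.1 * K < 2^-1 &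
                          nr p.1 * nr (g p.2) < r / 4]].

Definition shift_img : set (C * E) :=
  [set q | exists2 z, shift_dom (q.1, z) & shift_map q.1 z = q.2].

(** The value [w] is a mere default outside [shift_img]; on [shift_img] the chosen point is the only
    one, by [shift_map_inj]. *)
Definition shift_inv (t : C) (w : E) : E :=
  xget w [set z | shift_dom (t, z) /\ shift_map t z = w].

Lemma lip_ball_center z r K : lip_ball z r K -> D z.
Proof. by move=> [r0 _ h _]; apply: h; rewrite subrr nr0. Qed.

Lemma lip_ball_sub z r K x : lip_ball z r K -> nr (x - z) < r ->
  lip_ball x (r - nr (x - z)) K.
Proof.
move=> [r0 K0 hD hg] xz.
have sub y : nr (y - x) < r - nr (x - z) -> nr (y - z) < r.
  by have := nr_triangle y x z; nr_lra.
split=> // [|y /sub /hD //|y y' /sub ? /sub ?]; first by rewrite subr_gt0.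
exact: hg.
Qed.

(** On the ball [t g] is Lipschitz with constant 1/2, so at least half of [x - y] survives in the
    difference of the images. Injectivity and the Lipschitz bounds for the inverse and for the local
    logarithm all rest on this. *)
Lemma shift_map_expand z r K t x y : lip_ball z r K -> nr t * K <= 2^-1 ->
  nr (x - z) < r -> nr (y - z) < r ->
  nr (x - y) <= 2 * nr (shift_map t x - shift_map t y).
Proof.
move=> [r0 K0 hD hg] tK xz yz.
have -> : shift_map t x - shift_map t y = (x - y) - t *: (g x - g y).
  exact: subrBZ.
have := nrB (x - y - t *: (g x - g y)) (- (t *: (g x - g y))).
rewrite opprK subrK nrN nrZ.
have := hg _ _ xz yz.
have := nr_ge0 (x - y); have := nr_ge0 t.
set a := nr (x - y); set b := nr t; set c := nr (g x - g y); set d := nr _.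
move=> b0 a0 h1 h2.
have : b * c <= b * (K * a) by rewrite ler_wpM2l.
have : b * K * a <= 2^-1 * a by rewrite ler_wpM2r.
rewrite mulrA; nr_lra.
Qed.

Lemma shift_map_inj t x y : shift_dom (t, x) -> shift_dom (t, y) ->
  shift_map t x = shift_map t y -> x = y.
Proof.
(* The ball of larger radius is kept, so that both [t g x] and [t g y] are below a quarter of the
   same [r]. Equal images then give [y - x = t (g y - g x)], of norm below [r / 2]. *)
move=> Ux Uy; wlog : x y Ux Uy / exists r K, [/\ lip_ball x r K, nr t * K < 2^-1,
    nr t * nr (g x) < r / 4 & nr t * nr (g y) < r / 4].
  move=> h; case: (Ux) => r [K [/= a1 a2 a3]]; case: (Uy) => r' [K' [/= b1 b2 b3]].
  have [rr'|r'r] := leP r r'.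
    move=> /esym e; apply/esym; apply: h e => //; exists r', K'; split=> //.
    by apply: (lt_le_trans a3); rewrite ler_pM2r.
  apply: h => //; exists r, K; split=> //.
  by apply: (lt_trans b3); rewrite ltr_pM2r.
move=> [r [K [gx tK tx ty]]] e.
have r0 : 0 < r by case: gx.
have yx : nr (y - x) < r.
  have -> : y - x = t *: g y - t *: g x.
    move: e; rewrite /shift_map => e.
    by rewrite -{1}[y](subrK (t *: g y)) -e addrAC [x - _ - x]addrAC subrr add0r addrC.
  apply: (le_lt_trans (nrB _ _)); rewrite !nrZ; nr_lra.
have := shift_map_expand gx (ltW tK) (x := x) (y := y).
rewrite subrr nr0 e subrr nr0 mulr0 => /(_ r0 yx) h.
by apply/eqP; rewrite -subr_eq0; apply/eqP/nr_eq0/eqP; rewrite eq_le h nr_ge0.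
Qed.

(** A preimage of [w] is a fixed point of [T x = w + t g x]. The bound [rho / 2] makes [T] preserve
    the ball of radius [rho]; there the residual [nr (T x - x)] attains its minimum by compactness,
    and since [T] halves it, the minimum is 0. *)
Lemma shift_map_solve z r K t w rho : lip_ball z r K -> nr t * K <= 2^-1 ->
  0 < rho -> rho < r -> nr (w - shift_map t z) <= rho / 2 ->
  exists2 x, nr (x - z) <= rho & shift_map t x = w.
Proof.
move=> [r0 K0 hD hg] tK rho0 rhor hw.
pose B := [set x | nr (x - z) <= rho].
pose T x := w + t *: g x.
have Bz : B z by rewrite /B /= subrr nr0 ltW.
have gB x y : B x -> B y -> nr (T x - T y) <= 2^-1 * nr (x - y).
  move=> Bx By; rewrite /T opprD addrACA subrr add0r -scalerBr nrZ.
  have h := hg x y (le_lt_trans Bx rhor) (le_lt_trans By rhor).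
  apply: (@le_trans _ _ (nr t * (K * nr (x - y)))); first by rewrite ler_wpM2l ?nr_ge0.
  by rewrite mulrA ler_wpM2r ?nr_ge0.
have Tz : nr (T z - z) <= rho / 2.
  by rewrite (_ : T z - z = w - shift_map t z) // /shift_map opprB addrA.
have TB x : B x -> B (T x).
  move=> Bx; have := gB _ _ Bx Bz; have := nr_triangle (T x) (T z) z.
  by move: Bx; rewrite /B /=; nr_lra.
pose m x := nr (T x - x).
have cT : {in B, continuous T}.
  move=> x; rewrite inE => Bx; apply/continuous_nrP => e e0.
  have xr := le_lt_trans Bx rhor.
  apply/near_nrP; exists (Num.min e (r - nr (x - z))).
    by rewrite lt_min e0 subr_gt0.
  move=> y; rewrite lt_min => /andP[ye yr].
  have yz : nr (y - z) < r by have := nr_triangle y x z; nr_lra.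
  rewrite /T opprD addrACA subrr add0r -scalerBr nrZ.
  apply: (@le_trans _ _ (nr t * (K * nr (y - x)))).
    by rewrite ler_wpM2l ?nr_ge0 // hg.
  rewrite mulrA; have := nr_ge0 (y - x).
  have : nr t * K * nr (y - x) <= 2^-1 * nr (y - x) by rewrite ler_wpM2r ?nr_ge0.
  nr_lra.
have cm : {within B, continuous m}.
  apply: continuous_in_subspaceT => x Bx.
  apply: (@continuous_comp _ _ _ (fun x => T x - x)); last exact: nr_continuous.
  have Tx : T @ x --> T x by exact: (cT x Bx).
  apply: (@cvgB _ _ _ _ _ T id) => //; exact: cvg_id.
have B0 : B !=set0 by exists z.
have [x xB xmin] := compact_EVT_min B0 (@compact_balls z rho) cm.
rewrite inE in xB; exists x => //.
have TBx := TB _ xB.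
have := xmin (T x); rewrite inE => /(_ TBx) h1.
have h2 := gB _ _ TBx xB.
have /nr_eq0 Tx : nr (T x - x) = 0.
  by apply/eqP; rewrite eq_le nr_ge0 andbT; rewrite /m in h1; nr_lra.
by rewrite /shift_map -{1}[x](subrK (T x)) -opprB Tx oppr0 add0r /T addrK.
Qed.

End InverseMap.

(** * Inversion of [1 - t T] for a linear map [T] *)

Section Resolvent.
Variables (R : realType) (E : normedModType R[i]).
Hypothesis compact_balls : forall (z : E) r, compact [set x | nr (x - z) <= r].
Variables (T : {linear E -> E}) (t : R[i]) (K : R).
Hypothesis boundT : forall v, nr (T v) <= K * nr v.
Hypothesis K0 : 0 <= K.
Hypothesis tK : nr t * K <= 2^-1.

Lemma sub_contraction_ge v : nr v <= 2 * nr (v - t *: T v).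
Proof.
have := nrB (v - t *: T v) (- (t *: T v)); rewrite opprK subrK nrN nrZ.
have : nr t * nr (T v) <= nr t * (K * nr v) by rewrite ler_wpM2l ?nr_ge0.
have : nr t * K * nr v <= 2^-1 * nr v by rewrite ler_wpM2r ?nr_ge0.
rewrite mulrA; nr_lra.
Qed.

(** A linear [T] is globally Lipschitz, so [shift_map_solve] applies to it at 0 with a radius
    adapted to [v] and gives surjectivity. Injectivity, from [sub_contraction_ge], makes the chosen
    preimage linear in [v]. *)
Lemma resolvent_exists : exists B : {linear E -> E},
  [/\ forall v, B v - t *: T (B v) = v, forall v, B (v - t *: T v) = v &
      forall v, nr (B v) <= 2 * nr v].
Proof.
have onto v : exists x, x - t *: T x = v.
  have rho0 : 0 < 2 * nr v + 1 by rewrite ltr_wpDl // mulr_ge0 ?nr_ge0.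
  have lT : lip_ball setT T 0 (2 * nr v + 2) K.
    split=> // [|x y _ _]; first by rewrite ltr_wpDl // mulr_ge0 ?nr_ge0.
    by rewrite -linearB; exact: boundT.
  have [||x _ <-] := @shift_map_solve R E compact_balls setT T 0 _ K t v _ lT tK rho0.
  - by rewrite ltrD2l ltr1n.
  - by rewrite /shift_map linear0 scaler0 subr0 subr0; have := nr_ge0 v; nr_lra.
  - by exists x.
have inj x y : x - t *: T x = y - t *: T y -> x = y.
  move=> e; apply/eqP; rewrite -subr_eq0; apply/eqP/nr_eq0/eqP.
  rewrite eq_le nr_ge0 andbT; apply: (le_trans (sub_contraction_ge _)).
  by rewrite linearB -subrBZ e subrr nr0 mulr0.
have [b bE] := choice onto.
have b_linear : linear b.
  move=> a x y; apply: inj; rewrite bE linearP scalerDr opprD addrACA bE.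
  by rewrite scalerA [t * a]mulrC -scalerA -scalerBr bE.
pose B : {linear E -> E} := HB.pack b (GRing.isLinear.Build _ _ _ _ b b_linear).
exists B; split=> //= v.
  by apply: inj; rewrite bE.
by rewrite -{2}[v]bE sub_contraction_ge.
Qed.

End Resolvent.

(** * Openness of the domains and differentiability of the inverse map in [(t, w)] *)

Section InverseFunction.
Variables (R : realType) (E : normedModType R[i]).
Local Notation C := R[i].
Hypothesis compact_balls : forall (z : E) r, compact [set x | nr (x - z) <= r].
Variables (D : set E) (g : E -> E).
Local Notation lip_ball := (lip_ball D g).
Local Notation shift_map := (shift_map g).
Local Notation shift_dom := (shift_dom D g).
Local Notation shift_img := (shift_img D g).
Local Notation shift_inv := (shift_inv D g).

Lemma shift_dom_open : open shift_dom.
Proof.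
rewrite openE => -[t z] [r [K [/= gz tK tg]]]; have [r0 K0 _ hg] := gz.
have nt := nr_ge0 t; have ng := nr_ge0 (g z).
(* [S] bounds the growth rate of [nr t' * nr (g z')] in the displacement [m <= 1], where [m ^ 2] is
   replaced by [m]; its final 1 also absorbs the loss [m / 4] due to the shrinking radius. *)
pose S := nr (g z) + K * nr t + K + 1.
have S0 : 0 < S by rewrite /S ltr_wpDl // !addr_ge0 // mulr_ge0.
pose d := Num.min (Num.min 1 r) (Num.min ((r / 4 - nr t * nr (g z)) / S)
                                         ((2^-1 - nr t * K) / (K + 1))).
have K1 : 0 < K + 1 by rewrite ltr_wpDl.
apply: (near_nrP (t, z) shift_dom).2; exists d.
  by rewrite !lt_min ltr01 r0 !divr_gt0 ?subr_gt0.
move=> [t' z']; set m := nr _ => md.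
have [am em] : nr (t' - t) <= m /\ nr (z' - z) <= m.
  by rewrite /m nr_pair /= !le_max !lexx orbT.
have a0 := nr_ge0 (t' - t); have e0 := nr_ge0 (z' - z).
move: md; rewrite !lt_min !ltr_pdivlMr // => /andP[/andP[m1 mr] /andP[mS mK]].
have z'r : nr (z' - z) < r by nr_lra.
have nt' : nr t' <= nr t + m by have := nr_triangle t' t 0; rewrite !subr0; nr_lra.
have Km : K * nr (z' - z) <= K * m by rewrite ler_wpM2l.
have ng' : nr (g z') <= nr (g z) + K * m.
  have := hg z' z z'r; rewrite subrr nr0 => /(_ r0).
  by have := nr_triangle (g z') (g z) 0; rewrite !subr0; nr_lra.
exists (r - nr (z' - z)), K; split; first exact: lip_ball_sub.
  by have : nr t' * K <= (nr t + m) * K; [rewrite ler_wpM2r|rewrite /=; nr_lra].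
have : nr t' * nr (g z') <= (nr t + m) * (nr (g z) + K * m).
  by apply: ler_pM; rewrite ?nr_ge0.
have : m * (K * m) <= 1 * (K * m) by rewrite ler_wpM2r ?mulr_ge0 //; nr_lra.
move: mS; rewrite /S /=; nr_lra.
Qed.

Lemma shift_solve_near t z rho : shift_dom (t, z) -> 0 < rho ->
  \forall q \near (t, shift_map t z), exists2 x,
    nr (x - z) < rho & shift_dom (q.1, x) /\ shift_map q.1 x = q.2.
Proof.
move=> Uz rho0; have := shift_dom_open; rewrite openE => /(_ _ Uz) /near_nrP[d1 d10 hd1].
case: Uz => r [K [/= gz tK tg]]; have [r0 K0 _ _] := gz.
pose s := Num.min rho (Num.min d1 r).
have s0 : 0 < s by rewrite !lt_min rho0 d10.
have s1 : s <= rho by rewrite ge_min lexx.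
have s2 : s <= d1 by rewrite !ge_min lexx orbT.
have s3 : s <= r by rewrite !ge_min lexx !orbT.
have ng := nr_ge0 (g z).
have N0 : 0 < 8 * (1 + nr (g z)) by rewrite mulr_gt0 // ltr_wpDr.
have K1 : 0 < K + 1 by rewrite ltr_wpDl.
(* The equation is solved in the ball of radius [s / 2], which asks for a defect of at most [s / 4].
   The change of [w] and the term [(t' - t) g z] get [s / 8] each. *)
apply/near_nrP; exists (Num.min d1 (Num.min (s / (8 * (1 + nr (g z)))) ((2^-1 - nr t * K) / (K + 1)))).
  by rewrite !lt_min d10 !divr_gt0 ?subr_gt0.
move=> [t' w']; rewrite nr_pair /= gt_max !lt_min !ltr_pdivlMr //.
move=> /andP[/and3P[a1 a2 a3] /and3P[b1 b2 b3]].
have tK' : nr t' * K <= 2^-1.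
  have : nr t' <= nr t + nr (t' - t) by have := nr_triangle t' t 0; rewrite !subr0; nr_lra.
  have := nr_ge0 (t' - t) => c0 /(ler_wpM2r K0); nr_lra.
have := @shift_map_solve _ _ compact_balls _ _ z r K t' w' (s / 2) gz tK'.
case.
- by rewrite divr_gt0.
- nr_lra.
- have -> : w' - shift_map t' z = (w' - shift_map t z) + (t' - t) *: g z.
    rewrite /shift_map !opprB scalerBl -[RHS]addrA; congr (_ + _).
    by rewrite [RHS]addrC addrA subrK.
  apply: (le_trans (nrD _ _)); rewrite nrZ.
  have c1 := nr_ge0 (t' - t); have c2 := nr_ge0 (w' - shift_map t z).
  have := mulr_ge0 c2 ng; nr_lra.
- move=> x xs e; exists x; first nr_lra.
  split=> //; apply: hd1; rewrite nr_pair /= gt_max a1 /=; nr_lra.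
Qed.

Lemma shift_img_open : open shift_img.
Proof.
rewrite openE => -[t w] [z /= Uz zw].
have := shift_solve_near Uz (@ltr01 R); rewrite zw; apply: filterS => q [x _ [Ux xq]].
by exists x.
Qed.

Lemma shift_invP t w : shift_img (t, w) ->
  shift_dom (t, shift_inv t w) /\ shift_map t (shift_inv t w) = w.
Proof.
move=> [z Uz zw].
by have := @xgetPex _ w [set z | shift_dom (t, z) /\ shift_map t z = w]; apply; exists z.
Qed.

Lemma shift_invK t z : shift_dom (t, z) -> shift_inv t (shift_map t z) = z.
Proof.
move=> Uz; have [] := @shift_invP t (shift_map t z); first by exists z.
by move=> Ux e; exact: (shift_map_inj Ux Uz e).
Qed.

Lemma shift_inv_near p rho : shift_img p -> 0 < rho ->
  \forall q \near p, nr (shift_inv q.1 q.2 - shift_inv p.1 p.2) < rho.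
Proof.
case: p => t w /shift_invP[Uz zw] rho0 /=.
have := shift_solve_near Uz rho0; rewrite zw; apply: filterS => -[t' w'] /=.
by move=> [x xz [Ux <-]]; rewrite shift_invK.
Qed.

(** Both preimages are compared through [shift_map] at the same time [t], so that [shift_map_expand]
    applies; the change of time becomes the term [(t' - t) g z'], with [g z'] bounded by
    [nr (g z) + K r]. *)
Lemma shift_inv_lipschitz p : shift_img p ->
  exists2 L : R, 0 <= L & \forall q \near p,
    nr (shift_inv q.1 q.2 - shift_inv p.1 p.2) <= L * nr (q - p).
Proof.
case: p => t w Wp; have [Uz zw] := shift_invP Wp; set z := shift_inv t w in Uz zw.
have [r [K [/= gz tK tg]]] := Uz; have [r0 K0 _ hg] := gz.
exists (2 * (1 + (nr (g z) + K * r))).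
  by rewrite mulr_ge0 // addr_ge0 // addr_ge0 ?nr_ge0 // mulr_ge0 // ltW.
have := shift_img_open; rewrite openE => /(_ _ Wp).
have := shift_inv_near Wp r0; apply: filterS2 => -[t' w'] /= z'r Wq.
have [Uz' zw'] := shift_invP Wq; move: z'r Uz' zw'; rewrite -/z.
set z' := shift_inv t' w' => z'r Uz' zw'.
have rr : nr (z - z) < r by rewrite subrr nr0.
apply: (le_trans (shift_map_expand gz (ltW tK) z'r rr)).
have -> : shift_map t z' - shift_map t z = (w' - w) + (t' - t) *: g z'.
  by rewrite -zw -zw' /shift_map scalerBl [RHS]addrAC; congr (_ - _); rewrite addrA subrK.
rewrite -mulrA ler_pM2l // mulrDl mul1r; apply: (le_trans (nrD _ _)).
have [h1 h2] : nr (t' - t) <= nr ((t', w') - (t, w)) /\ nr (w' - w) <= nr ((t', w') - (t, w)).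
  by rewrite nr_pair /= !le_max !lexx orbT.
apply: lerD => //; rewrite nrZ mulrC; apply: ler_pM => //; try exact: nr_ge0.
have := nr_triangle (g z') (g z) 0; rewrite !subr0 => /le_trans; apply.
by rewrite addrC lerD2l (le_trans (hg _ _ z'r rr)) // ler_wpM2l // ltW.
Qed.

Lemma shift_inv_continuous p : shift_img p ->
  {for p, continuous (fun q => shift_inv q.1 q.2)}.
Proof.
move=> Wp; apply/continuous_nrP => e e0.
by have := shift_inv_near Wp e0; apply: filterS => q /ltW.
Qed.

Hypothesis dg : forall z, D z -> differentiable g z.

Lemma lip_ball_diff_bound z r K x : lip_ball z r K -> nr (x - z) < r ->
  forall v, nr ('d g x v) <= K * nr v.
Proof.
move=> gz xz; have gx := lip_ball_sub gz xz; apply: diff_bound.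
  exact: dg (lip_ball_center gx).
have [r0 _ _ hg] := gx; apply/near_nrP; exists (r - nr (x - z)) => // y yx.
by apply: hg; rewrite // subrr nr0.
Qed.

(** Implicit differentiation of [w = G - t g(G)]: with [B] the inverse of [1 - t dg], the candidate
    differential is [v |-> B (v.2 + v.1 g(G))]. Writing [z' - z] as [B] of its image reduces the
    remainder to [(t' - t) (g z' - g z) + t r1], a quadratic term plus the little-o of [g]. *)
Lemma shift_inv_diff p : shift_img p ->
  let G q := shift_inv q.1 q.2 in
  differentiable G p /\
  forall v, 'd G p v - p.1 *: 'd g (G p) ('d G p v) = v.2 + v.1 *: g (G p).
Proof.
case: p => t w Wp G; have [Uz zw] := shift_invP Wp.
have [L L0 hL] := shift_inv_lipschitz Wp.
rewrite /G [(t, w).1]/= [(t, w).2]/= in hL *.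
set z := shift_inv t w in Uz zw hL *.
have [r [K [/= gz tK tg]]] := Uz; have [r0 K0 _ hg] := gz.
have rr : nr (z - z) < r by rewrite subrr nr0.
have bd := lip_ball_diff_bound gz rr.
have ng := nr_ge0 (g z).
have nt := nr_ge0 t.
have [B [BE BK Bb]] := resolvent_exists compact_balls bd K0 (ltW tK).
pose dG (p : C * E) : E := B (p.2 + p.1 *: g z).
have dG_linear : linear dG.
  move=> a [p1 p2] [q1 q2]; rewrite /dG -linearP /=; congr (B _).
  by rewrite scalerDr addrACA scalerA -scalerDl.
pose LG : {linear (C * E)%type -> E} := HB.pack dG (GRing.isLinear.Build _ _ _ _ dG dG_linear).
suff H : is_diff (t, w) (fun q => shift_inv q.1 q.2) LG.
  split; first exact: ex_diff.
  by move=> v; rewrite (diff_val (is_diff_def := H)) /= /dG BE.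
apply: diff_nrP.
  apply: (@linear_nr_continuous _ _ _ _ (2 * (1 + nr (g z)))) => -[a v].
  rewrite /= /dG /=; apply: (le_trans (Bb _)).
  rewrite -mulrA ler_pM2l // mulrDl mul1r; apply: (le_trans (nrD _ _)).
  rewrite nr_pair /= lerD ?le_max ?lexx ?orbT // nrZ mulrC ler_wpM2l //.
  by rewrite le_max lexx.
move=> e e0.
(* [e1] and, below, [d2] hold the little-o and the quadratic term to [e / 4] each; the factor 2 in
   the bound on [B] brings the total to [e]. *)
pose e1 := e / (4 * (L + 1) * (nr t + 1)).
have L1 : 0 < L + 1 by rewrite ltr_wpDl.
have t1 : 0 < nr t + 1 by rewrite ltr_wpDl.
have K1 : 0 < K + 1 by rewrite ltr_wpDl.
have e10 : 0 < e1 by rewrite divr_gt0 // !mulr_gt0.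
have /near_nrP[d1 d10 hd1] := diff_nr (dg (lip_ball_center gz)) e10.
pose d2 := e / (4 * (L + 1) * (K + 1)).
have d20 : 0 < d2 by rewrite divr_gt0 // !mulr_gt0.
have := shift_img_open; rewrite openE => /(_ _ Wp) Wnear.
have wd := near_nr_lt (t, w) d20.
have rd0 : 0 < Num.min r d1 by rewrite lt_min r0.
suff key (q : C * E) : nr (shift_inv q.1 q.2 - z) <= L * nr (q - (t, w)) ->
    nr (shift_inv q.1 q.2 - z) < Num.min r d1 -> shift_img q -> nr (q - (t, w)) < d2 ->
    nr (shift_inv q.1 q.2 - z - LG (q - (t, w))) <= e * nr (q - (t, w)).
  near=> q; apply: key; near: q => //.
  exact: shift_inv_near Wp rd0.
case: q => t' w' /= {}hL; rewrite lt_min => /andP[z'r z'd] Wq qd.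
have [Uz' zw'] := shift_invP Wq; move: hL z'r z'd Uz' zw'; rewrite -/z.
set z' := shift_inv t' w' => hL z'r z'd Uz' zw'.
have := hd1 _ z'd; set r1 := (g z' - g z - _) => hr1.
rewrite -{1}(BK (z' - z)) /= /dG -linearB /=.
apply: (le_trans (Bb _)).
have -> : z' - z - t *: 'd g z (z' - z) - (w' - w + (t' - t) *: g z) =
    (t' - t) *: (g z' - g z) + t *: r1.
  by rewrite -zw -zw' /shift_map /r1 !scalerBr !scalerBl [X in _ - (X + _)]subrBB; exact: subr_expansion.
have gg := hg _ _ z'r rr.
set q := nr ((t', w') - (t, w)) in hL qd *.
have tq : nr (t' - t) <= q by rewrite /q nr_pair /= le_max lexx.
have q0 : 0 <= q := nr_ge0 _.
have : nr ((t' - t) *: (g z' - g z) + t *: r1) <= q * (K * (L * q)) + nr t * (e1 * (L * q)).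
  apply: (le_trans (nrD _ _)); rewrite !nrZ; apply: lerD.
    by apply: ler_pM; rewrite ?nr_ge0 // (le_trans gg) // ler_wpM2l.
  by rewrite ler_wpM2l // (le_trans hr1) // ler_wpM2l // ltW.
move=> /(ler_wpM2l (ler0n R 2)) /le_trans; apply.
have -> : 2 * (q * (K * (L * q)) + nr t * (e1 * (L * q))) =
  2 * (q * K * L + nr t * e1 * L) * q by ring.
rewrite ler_wpM2r //.
have : q * K * L <= e / 4.
  apply: (@le_trans _ _ (d2 * ((L + 1) * (K + 1)))).
    rewrite -mulrA [K * L]mulrC; apply: ler_pM => //; first exact: mulr_ge0.
      exact: ltW.
    by apply: ler_pM => //; rewrite lerDl.
  by rewrite /d2 le_eqVlt; apply/orP; left; apply/eqP; field; rewrite !gt_eqF.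
have : nr t * e1 * L <= e / 4.
  apply: (@le_trans _ _ (e1 * ((L + 1) * (nr t + 1)))).
    rewrite [nr t * _]mulrC -mulrA [nr t * L]mulrC; rewrite ler_pM2l //.
    by apply: ler_pM => //; rewrite lerDl.
  by rewrite /e1 le_eqVlt; apply/orP; left; apply/eqP; field; rewrite !gt_eqF.
nr_lra.
Unshelve. all: by end_near.
Qed.

End InverseFunction.


(** * The solution of the Hamilton-Jacobi equation *)

Lemma near_eq_continuous (R : realType) (V W : normedModType R[i]) (f h : V -> W) p :
  (\forall q \near p, f q = h q) -> {for p, continuous h} -> {for p, continuous f}.
Proof.
move=> fh /continuous_nrP ch; apply/continuous_nrP => e e0.
have fhp := nbhs_singleton fh.
by move: fh (ch e e0); apply: filterS2 => q -> ; rewrite fhp.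
Qed.

Lemma near_eq_diff (R : realType) (V W : normedModType R[i]) (f h : V -> W) p :
  (\forall q \near p, f q = h q) -> differentiable h p -> is_diff p f ('d h p).
Proof.
move=> fh dh; apply: diff_nrP; first exact: diff_continuous.
move=> e e0; have fhp := nbhs_singleton fh.
by move: fh (diff_nr dh e0); apply: filterS2 => q -> ; rewrite fhp.
Qed.

Lemma subr_telescope (V : zmodType) (a b c k l m : V) :
  (a + b) - (a + c + m - l) = b - c + (l - k) + (k - m).
Proof.
rewrite -[RHS]addrA (addrA (l - k)) subrK -(addrA (a + c)) (opprD (a + c)).
rewrite opprB [LHS]addrA; congr (_ + _).
by rewrite opprD addrACA subrr add0r.
Qed.

(** * Continuity of the derivative of [g o G] *)

Section InverseSecondOrder.
Variables (R : realType) (E : normedModType R[i]).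
Local Notation C := R[i].
Hypothesis compact_balls : forall (z : E) r, compact [set x | nr (x - z) <= r].
Variables (D : set E) (g : E -> E).
Hypothesis diff_g : forall z, D z -> differentiable g z.
Hypothesis dg_continuous : forall z v, D z -> {for z, continuous (fun x => 'd g x v)}.
Let G (p : C * E) : E := shift_inv D g p.1 p.2.

(** Continuity of [dg] is assumed for each fixed direction, not in operator norm, so the direction
    is frozen at ['d G p u] in [a]. The difference [x - y] of the two values of [dG u] is controlled
    by subtracting their implicit equations and applying [sub_contraction_ge]. *)
Lemma shift_inv_diff_continuous p u : shift_img D g p ->
  {for p, continuous (fun q => 'd g (G q) ('d G q u))}.
Proof.
move=> Wp.
have GE q := @shift_inv_diff _ _ compact_balls D g diff_g q.
have cG : {for p, continuous G} by exact: shift_inv_continuous.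
have [r [K [gz tK tg]]] : shift_dom D g (p.1, G p).
  by case: (p) Wp => t w /shift_invP[].
rewrite /= in gz tK tg; have [r0 K0 _ _] := gz.
have Dz := lip_ball_center gz.
pose a q := 'd g (G q) ('d G p u).
have ca : {for p, continuous a}.
  exact: (@continuous_comp _ _ _ G (fun x => 'd g x ('d G p u)) p cG (dg_continuous Dz)).
have cg : {for p, continuous (g \o G)}.
  apply: (@continuous_comp _ _ _ G g p cG).
  exact: differentiable_continuous (diff_g Dz).
apply/continuous_nrP => e e0.
have nt := nr_ge0 p.1; have nu := nr_ge0 u.1; have na := nr_ge0 (a p).
(* The final estimate is [K nr (x - y) + d], with [nr (x - y)] at most [2 d] times the parenthesis;
   hence [d S <= e] suffices. *)
pose S := 2 * K * (nr u.1 + nr p.1 + 1 + nr (a p)) + 1.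
have S0 : 0 < S by rewrite /S ltr_wpDl // !mulr_ge0 // !addr_ge0.
pose d := Num.min 1 (Num.min (e / S) ((2^-1 - nr p.1 * K) / (K + 1))).
have K1 : 0 < K + 1 by rewrite ltr_wpDl.
have d0 : 0 < d by rewrite !lt_min ltr01 !divr_gt0 // subr_gt0.
have := @shift_img_open _ _ compact_balls D g; rewrite openE => /(_ _ Wp) nW.
have nG := shift_inv_near compact_balls Wp r0.
have n1 := (continuous_nrP _ _).1 ca d d0.
have n2 := (continuous_nrP _ _).1 cg d d0.
have n3 := near_nr_lt p d0.
suff key (q : C * E) : shift_img D g q -> nr (G q - G p) < r ->
    nr (a q - a p) <= d -> nr (g (G q) - g (G p)) <= d -> nr (q - p) < d ->
    nr ('d g (G q) ('d G q u) - 'd g (G p) ('d G p u)) <= e.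
  by near=> q; apply: key; near: q.
move=> Wq Gq h1 h2 h3.
have {}h3 : nr (q.1 - p.1) < d by apply: le_lt_trans h3; rewrite nr_pair le_max lexx.
have d1 : d <= 1 by rewrite ge_min lexx.
have dS : d * S <= e by rewrite -ler_pdivlMr // !ge_min lexx orbT.
have dK : d * (K + 1) <= 2^-1 - nr p.1 * K by rewrite -ler_pdivlMr // !ge_min lexx !orbT.
have nq : nr q.1 <= nr p.1 + d.
  by have := nr_triangle q.1 p.1 0; rewrite !subr0; nr_lra.
have qK : nr q.1 * K <= 2^-1.
  by have : nr q.1 * K <= (nr p.1 + d) * K; [rewrite ler_wpM2r|nr_lra].
have bd := lip_ball_diff_bound diff_g gz Gq.
pose x := 'd G q u; pose y := 'd G p u.
have xq : x - q.1 *: 'd g (G q) x = u.2 + u.1 *: g (G q).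
  exact: (GE _ Wq).2.
have xp : y - p.1 *: 'd g (G p) y = u.2 + u.1 *: g (G p).
  exact: (GE _ Wp).2.
have xy : nr (x - y) <= 2 * (nr u.1 * d + (nr p.1 + 1) * d + d * nr (a p)).
  have h := sub_contraction_ge bd K0 qK (x - y).
  apply: (le_trans h); rewrite ler_pM2l //.
  have -> : x - y - q.1 *: 'd g (G q) (x - y) =
      u.1 *: (g (G q) - g (G p)) + q.1 *: (a q - a p) + (q.1 - p.1) *: a p.
    have yE : y = u.2 + u.1 *: g (G p) + p.1 *: a p by rewrite -xp subrK.
    rewrite linearB -subrBZ xq {1}yE !scalerBr scalerBl; exact: subr_telescope.
  apply: (le_trans (nrD _ _)); rewrite nrZ; apply: lerD.
    apply: (le_trans (nrD _ _)); rewrite !nrZ; apply: lerD; first by rewrite ler_wpM2l.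
    by apply: ler_pM; rewrite ?nr_ge0 // (le_trans nq) // lerD2l.
  by rewrite ler_wpM2r // ltW.
have -> : 'd g (G q) x - 'd g (G p) y = 'd g (G q) (x - y) + (a q - a p).
  by rewrite linearB addrA subrK.
apply: (le_trans (nrD _ _)).
have := bd (x - y); have := ler_wpM2l K0 xy; move: dS; rewrite /S.
nr_lra.
Unshelve. all: by end_near.
Qed.

End InverseSecondOrder.

(** * The complex bilinear form: continuity and product rule *)

Section Bilin.
Variables (R : realType) (n : nat).
Local Notation C := R[i].
Local Notation Cn := 'rV[C]_n.

Lemma bilinC (a b : Cn) : bilin a b = bilin b a.
Proof. by apply: eq_bigr => i _; rewrite mulrC. Qed.

Lemma bilinDr (a b c : Cn) : bilin a (b + c) = bilin a b + bilin a c.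
Proof. by rewrite -big_split; apply: eq_bigr => i _; rewrite mxE mulrDr. Qed.

Lemma bilinZr (a b : Cn) (k : C) : bilin a (k *: b) = k * bilin a b.
Proof. by rewrite big_distrr; apply: eq_bigr => i _ /=; rewrite mxE mulrCA. Qed.

Lemma bilinBr (a b c : Cn) : bilin a (b - c) = bilin a b - bilin a c.
Proof. by rewrite bilinDr -scaleN1r bilinZr mulN1r. Qed.

Lemma bilin0r (a : Cn) : bilin a 0 = 0.
Proof. by apply: big1 => i _; rewrite mxE mulr0. Qed.

Lemma bilin_delta (a : Cn) i : bilin a (delta_mx 0 i) = a 0 i.
Proof.
rewrite /bilin (bigD1 i) //= mxE !eqxx mulr1 big1 ?addr0 // => j ji.
by rewrite mxE (negPf ji) andbF mulr0.
Qed.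

Lemma bilin_is_bilinear : bilinear_for
  (GRing.Scale.Law.clone _ _ *:%R _) (GRing.Scale.Law.clone _ _ *:%R _)
  (@bilin R n).
Proof.
split=> [b|a] k x y /=; last by rewrite bilinDr bilinZr.
by rewrite bilinC bilinDr bilinZr !(bilinC b).
Qed.

HB.instance Definition _ :=
  bilinear_isBilinear.Build C Cn Cn C _ _ (@bilin R n) bilin_is_bilinear.

Lemma coord_comp_continuous (T : topologicalType) (f : T -> Cn) p i :
  {for p, continuous f} -> {for p, continuous (fun q => f q 0 i : C)}.
Proof.
move=> /cvg_nrP h; apply/cvg_nrP => e e0; have := h e e0; apply: filterS => q.
by apply: le_trans; have := nr_coord (f q - f p) i; rewrite !mxE.
Qed.

Lemma bilin_continuous (T : topologicalType) (f h : T -> Cn) p :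
  {for p, continuous f} -> {for p, continuous h} ->
  {for p, continuous (fun q => bilin (f q) (h q))}.
Proof.
move=> cf ch; apply: cvg_big; first exact: add_continuous.
by move=> i _; apply: cvgM; exact: coord_comp_continuous.
Qed.

Lemma bilin_affine_continuous (T : topologicalType) (f h : T -> Cn) a c p :
  {for p, continuous f} -> {for p, continuous h} ->
  {for p, continuous (fun q => bilin (f q) a + c * bilin (h q) (f q))}.
Proof.
move=> cf ch.
have c1 : {for p, continuous (fun q => bilin (f q) a)}.
  have ca : {for p, continuous (fun _ : T => a)} by exact: cvg_cst.
  exact: (bilin_continuous cf ca).
have c2 := bilin_continuous ch cf.
apply/cvg_nrP => e e0.
have N0 : 0 < 2 * (nr c + 1) by rewrite mulr_gt0 // ltr_wpDl ?nr_ge0.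
have e2 : 0 < e / 2 by rewrite divr_gt0.
move: c1 => /cvg_nrP /(_ _ e2) n1.
move: c2 => /cvg_nrP /(_ _ (divr_gt0 e0 N0)) n2.
move: n1 n2; apply: filterS2 => q h1; rewrite ler_pdivlMr // => h2.
rewrite opprD addrACA -mulrBr; apply: (le_trans (nrD _ _)); rewrite nrM.
move: h1 h2; have := nr_ge0 (bilin (h q) (f q) - bilin (h p) (f p)).
move: (nr c) (nr _) (nr _) => x y z; nra.
Qed.

Lemma bilin_diff (V : normedModType C) (f h : V -> Cn) p :
  differentiable f p -> differentiable h p ->
  differentiable (fun q => bilin (f q) (h q)) p /\
  forall v, 'd (fun q => bilin (f q) (h q)) p v =
    bilin ('d f p v) (h p) + bilin (f p) ('d h p v).
Proof.
move=> df dh.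
have cb : continuous (fun p : Cn * Cn => bilin p.1 p.2).
  by move=> q; apply: bilin_continuous; [exact: cvg_fst|exact: cvg_snd].
have dB q := @differentiable_bilin _ _ _ _ (@bilin R n) q cb.
have dp := differentiable_pair df dh.
have e : (fun q => bilin (f q) (h q)) =
  (fun q : Cn * Cn => bilin q.1 q.2) \o (fun q => (f q, h q)) by [].
split; first by rewrite e; exact: differentiable_comp.
move=> v; rewrite e diff_comp //= diff_bilin // diff_pair //= addrC.
by [].
Qed.

End Bilin.

(** The two difference quotients are the same function of [h]. Partial derivatives of [q t] can thus
    be read off the joint differential in [(t, w)]. *)
Lemma derive_slice (R : realType) (E : normedModType R[i]) (q : R[i] -> E -> R[i]) t w v :
  'D_v (q t) w = 'D_((0 : R[i], v)) (fun p : R[i] * E => q p.1 p.2) (t, w).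
Proof.
have e : (fun h : R[i] => h^-1 *: ((q t \o shift w) (h *: v) - q t w)) =
    fun h => h^-1 *: (((fun p : R[i] * E => q p.1 p.2) \o shift (t, w))
                        (h *: ((0, v) : R[i] * E)) - q t w).
  by apply/funext => h /=; rewrite scaler0 add0r.
by rewrite /derive e.
Qed.

Lemma derive1_slice (R : realType) (E : normedModType R[i]) (q : R[i] -> E -> R[i]) t w :
  derive1 (fun s => q s w) t =
  'D_((1 : R[i], 0 : E)) (fun p : R[i] * E => q p.1 p.2) (t, w).
Proof.
have e : (fun h : R[i] => h^-1 *: (q (h + t) w - q t w)) =
    fun h => h^-1 *: (((fun p : R[i] * E => q p.1 p.2) \o shift (t, w))
                        (h *: ((1, 0) : R[i] * E)) - q t w).
  by apply/funext => h /=; rewrite scaler0 add0r [h *: 1]mulr1.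
by rewrite /derive1 /derive e.
Qed.

(** * Existence by characteristics *)

Section HamiltonJacobi.
Variables (R : realType) (n : nat).
Local Notation C := R[i].
Local Notation Cn := 'rV[C]_n.
Variables (D : set Cn) (P : Cn -> C) (g : Cn -> Cn).
Hypothesis lip_g : forall z, D z -> exists r K, lip_ball D g z r K.
Hypothesis diff_g : forall z, D z -> differentiable g z.
Hypothesis dg_continuous : forall z v, D z -> {for z, continuous (fun x => 'd g x v)}.
Hypothesis diff_P : forall z, D z -> differentiable P z.
Hypothesis diff_PE : forall z v, D z -> 'd P z v = bilin (g z) v.
Local Notation W := (shift_img D g).
Let G (p : C * Cn) : Cn := shift_inv D g p.1 p.2.
Let g' : C * Cn -> Cn := g \o G.

(* The value transported along the characteristic [w = z - t g z], on which
   [dQ/dt = - <g z, g z> / 2]. *)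
Definition hj_sol (t : C) (w : Cn) : C :=
  P (shift_inv D g t w) -
  2^-1 * t * bilin (g (shift_inv D g t w)) (g (shift_inv D g t w)).

Let Q (p : C * Cn) := hj_sol p.1 p.2.

Lemma inv_mem p : W p -> D (G p).
Proof. by case: p => t w /shift_invP[[r [K [/lip_ball_center]]]]. Qed.

Lemma inv_diff p : W p -> differentiable G p /\
  forall v, 'd G p v - p.1 *: 'd g (G p) ('d G p v) = v.2 + v.1 *: g' p.
Proof. exact: (shift_inv_diff (@closed_ball_compact R n) diff_g). Qed.

Lemma gradient_diff p : W p -> differentiable g' p /\
  forall v, 'd g' p v = 'd g (G p) ('d G p v).
Proof.
move=> Wp; have [dG _] := inv_diff Wp; have dg := diff_g (inv_mem Wp).
split; first exact: (differentiable_comp dG dg).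
by move=> v; exact: (congr1 (fun h : C * Cn -> Cn => h v) (diff_comp dG dg)).
Qed.

(** The unknown [dG] cancels. Differentiation produces [<g', dG v> - t <g', dg (dG v)>], which is
    the implicit equation for [dG] paired with [g'], hence equals [<g', v.2> + v.1 <g', g'>]; the
    derivative of the factor [t] takes away half of the last term. *)
Lemma hj_sol_diff p : W p -> differentiable Q p /\
  forall v, 'd Q p v = bilin (g' p) v.2 + 2^-1 * v.1 * bilin (g' p) (g' p).
Proof.
move=> Wp; have [dG dGE] := inv_diff Wp; have [dg' dg'E] := gradient_diff Wp.
have dP := diff_P (inv_mem Wp).
have [dB dBE] := bilin_diff dg' dg'.
pose B q := bilin (g' q) (g' q).
pose c (q : C * Cn) : C := 2^-1 * q.1.
have dc : is_diff p c c.
  have cl : linear c by move=> a q1 q2; rewrite /c mulrDr mulrCA.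
  pose cL : {linear (C * Cn)%type -> C} := HB.pack c (GRing.isLinear.Build _ _ _ _ c cl).
  have cc : continuous cL.
    apply: (@linear_nr_continuous _ _ _ _ (nr (2^-1 : C))) => q /=.
    by rewrite nrM ler_wpM2l ?nr_ge0 // nr_pair le_max lexx.
  have := linear_differentiable p cc.
  by move=> dcL; split; [exact: dcL|exact: (diff_lin p cc)].
have {}dc : differentiable c p /\ 'd c p = c :> (C * Cn -> C).
  by split; [exact: ex_diff|exact: (diff_val (is_diff_def := dc))].
case: dc => dc dcE.
have dPG := differentiable_comp dG dP.
have dcB := differentiableM dc dB.
split; first exact: (differentiableB dPG dcB).
move=> v.
have e1 : 'd (P \o G) p v = bilin (g' p) ('d G p v).
  rewrite -[RHS]/(bilin (g (G p)) ('d G p v)) -(diff_PE _ (inv_mem Wp)).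
  exact: (congr1 (fun h : C * Cn -> C => h v) (diff_comp dG dP)).
have e2 : 'd (c * B) p v = c p * 'd B p v + B p * 'd c p v.
  exact: (congr1 (fun h : C * Cn -> C => h v) (diffM dc dB)).
have e2c : 'd c p v = c v := congr1 (fun h : C * Cn -> C => h v) dcE.
have e3 : 'd Q p v = 'd (P \o G) p v - 'd (c * B) p v.
  exact: (congr1 (fun h : C * Cn -> C => h v) (diffB dPG dcB)).
have dB2 : 'd B p v = 2 * bilin (g' p) ('d g (G p) ('d G p v)).
  have aux (k k' : Cn) : k = k' ->
      bilin k (g' p) + bilin (g' p) k = 2 * bilin (g' p) k'.
    by move=> ->; rewrite bilinC mulr_natl mulr2n.
  exact: (etrans (dBE v) (aux _ _ (dg'E v))).
apply: (etrans e3); apply: (etrans (congr2 (fun a b => a - b) e1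
  (etrans e2 (congr2 (fun a b => c p * a + B p * b) dB2 e2c)))).
have := congr1 (bilin (g' p)) (dGE v).
rewrite bilinBr bilinDr !bilinZr /c /B.
move: (bilin (g' p) ('d g (G p) ('d G p v))) => x.
move: (bilin (g' p) ('d G p v)) => y e.
have -> : bilin (g' p) v.2 = y - p.1 * x - v.1 * bilin (g' p) (g' p) by rewrite e addrK.
by field.
Qed.

Let hj_derivative (v p : C * Cn) : C :=
  bilin (g' p) v.2 + 2^-1 * v.1 * bilin (g' p) (g' p).

Lemma hj_sol_derive p v : W p -> 'D_v Q p = hj_derivative v p.
Proof.
by move=> /hj_sol_diff[dQ dQE]; exact: (etrans (deriveE v dQ) (dQE v)).
Qed.

Lemma hj_derivative_diff v p : W p -> differentiable (hj_derivative v) p /\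
  forall u, 'd (hj_derivative v) p u =
    bilin ('d g (G p) ('d G p u)) v.2 +
    v.1 * bilin (g' p) ('d g (G p) ('d G p u)).
Proof.
move=> Wp; have [dg' dg'E] := gradient_diff Wp.
have [dB dBE] := bilin_diff dg' dg'.
have [dL dLE] := bilin_diff dg' (differentiable_cst v.2 p).
have dkB := differentiableZ (2^-1 * v.1) dB.
have e0 : hj_derivative v = (fun q => bilin (g' q) (cst v.2 q)) +
  (2^-1 * v.1) \*: (fun q => bilin (g' q) (g' q)) by [].
rewrite e0; split; first exact: (differentiableD dL dkB).
move=> u.
have e1 := congr1 (fun h : C * Cn -> C => h u) (diffD dL dkB).
have e2 := congr1 (fun h : C * Cn -> C => h u) (diffZ (2^-1 * v.1) dB).
have e3 := congr1 (fun h : C * Cn -> Cn => h u) (diff_cst v.2 p).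
have aux (a k k' z : Cn) c : k = k' -> z = 0 ->
    bilin k v.2 + bilin a z + 2^-1 * c * (bilin k a + bilin a k) =
    bilin k' v.2 + c * bilin a k'.
  move=> -> ->; rewrite bilin0r addr0 (bilinC k' a); congr (_ + _).
  by move: (bilin a k') => x; field.
apply: (etrans e1).
apply: (etrans (congr2 +%R (dLE u) (etrans e2 (congr1 ( *%R (2^-1 * v.1)) (dBE u))))).
exact: (aux _ _ _ _ _ (dg'E u) e3).
Qed.

(** On the open set [W] each ['D_v Q] coincides with the explicit [hj_derivative v], so it inherits
    its differential. The second derivatives are continuous expressions in [g'] and [k], the latter
    by [shift_inv_diff_continuous]. *)
Lemma hj_sol_holo2 : holo2 W Q.
Proof.
have Wnear p : W p -> \forall q \near p, W q.
  by have := @shift_img_open _ _ (@closed_ball_compact R n) D g; rewrite openE => h /h.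
have D1 v p : W p -> is_diff p ('D_v Q) ('d (hj_derivative v) p).
  move=> Wp; apply: near_eq_diff (hj_derivative_diff v Wp).1.
  by have := Wnear p Wp; apply: filterS => q /hj_sol_derive.
move=> p Wp; split; first exact: (hj_sol_diff Wp).1.
move=> v; split; first exact: (@ex_diff _ _ _ _ _ _ _ (D1 v p Wp)).
move=> u.
pose k q := 'd g (G q) ('d G q u).
have ck : {for p, continuous k}.
  exact: (shift_inv_diff_continuous (@closed_ball_compact R n) diff_g dg_continuous).
have cg : {for p, continuous g'} by exact: differentiable_continuous (gradient_diff Wp).1.
have DE q : W q -> 'D_u ('D_v Q) q = bilin (k q) v.2 + v.1 * bilin (g' q) (k q).
  move=> Wq; have dq := D1 v q Wq.
  apply: (etrans (deriveE u (@ex_diff _ _ _ _ _ _ _ dq))).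
  apply: (etrans (congr1 (fun h : C * Cn -> C => h u) (@diff_val _ _ _ _ _ _ _ dq))).
  exact: (hj_derivative_diff v Wq).2.
have cf : {for p, continuous (fun q => bilin (k q) v.2 + v.1 * bilin (g' q) (k q))}.
  exact: bilin_affine_continuous ck cg.
apply/continuous_nrP => e e0; move: (Wnear p Wp) ((continuous_nrP _ _).1 cf e e0).
by apply: filterS2 => q Wq; rewrite (DE q Wq) (DE p Wp).
Qed.

Lemma grad_hj_sol t w : W (t, w) -> grad (hj_sol t) w = g (shift_inv D g t w).
Proof.
move=> Wp; apply/rowP => i; rewrite mxE.
apply: (etrans (derive_slice _ _ _ _)); apply: (etrans (hj_sol_derive _ Wp)).
by rewrite /hj_derivative /= mulr0 mul0r addr0 bilin_delta.
Qed.

Lemma shift_dom_slice : slice_nbhd D (shift_dom D g).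
Proof.
split; first exact: shift_dom_open.
move=> z Dz; have [r [K gz]] := lip_g Dz; exists r, K; split=> //=.
  by rewrite nr0 mul0r invr_gt0.
by rewrite nr0 mul0r divr_gt0 //; case: gz.
Qed.

Lemma hj_sol_solution : HJ_solution D P W hj_sol.
Proof.
split; first exact: hj_sol_holo2.
  move=> t z Wp; rewrite grad_hj_sol //.
  apply: (etrans (derive1_slice _ _ _)); apply: (etrans (hj_sol_derive _ Wp)).
  by rewrite /hj_derivative /= bilin0r add0r mulr1.
move=> z Dz; have U0 := shift_dom_slice.2 z Dz.
have e : shift_inv D g 0 z = z.
  by have := shift_invK U0; rewrite /shift_map scale0r subr0.
by rewrite /hj_sol e mulr0 mul0r subr0.
Qed.

Lemma shift_img_slice : slice_nbhd D W.
Proof.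
split; first exact: (@shift_img_open _ _ (@closed_ball_compact R n)).
move=> z Dz; exists z; first exact: shift_dom_slice.2.
by rewrite /shift_map /= scale0r subr0.
Qed.

(** Since [grad Q_t = g o G_t], adding [t grad Q_t] undoes the shift. [F] is constrained on [D]
    only, because that is where [grad P] is known to be [g]. *)
Lemma hj_sol_inverse (F : C -> Cn -> Cn) :
  (forall t z, D z -> F t z = shift_map g t z) ->
  slicewise_inverse (shift_dom D g) W F (deformG hj_sol).
Proof.
move=> FE; split=> [t z Uz|t w Wp].
  have Dz : D z by case: Uz => r [K [/lip_ball_center]].
  have Wz : W (t, F t z) by exists z => //=; rewrite FE.
  split=> //; rewrite /deformG grad_hj_sol // FE // shift_invK //.
  by rewrite /shift_map subrK.
have [Uz zw] := shift_invP Wp.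
have -> : deformG hj_sol t w = shift_inv D g t w.
  by rewrite /deformG grad_hj_sol // -{1}zw /shift_map subrK.
by split=> //; rewrite FE //; case: Uz => r [K [/lip_ball_center]].
Qed.

End HamiltonJacobi.


(** * Branches of the logarithm *)

Section ComplexExponential.
Variable R : realType.
Local Notation C := R[i].
Implicit Types w : C.

Lemma cexpD w w' : cexp (w + w') = cexp w * cexp w'.
Proof.
case: w w' => a b [c d]; rewrite /cexp /= expRD cosD sinD.
by apply/eqP; rewrite eq_complex /=; apply/andP; split; apply/eqP; ring.
Qed.

Lemma cexp0 : cexp (0 : C) = 1.
Proof. by rewrite /cexp /= expR0 cos0 sin0; simpc. Qed.

Lemma cexp_neq0 w : cexp w != 0.
Proof.
have : cexp w * cexp (- w) = 1 by rewrite -cexpD subrr cexp0.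
by move=> h; apply/negP => /eqP h0; move/eqP: h; rewrite h0 mul0r eq_sym oner_eq0.
Qed.

Lemma cexpN w : cexp (- w) = (cexp w)^-1.
Proof.
by apply: (mulfI (cexp_neq0 w)); rewrite -cexpD subrr cexp0 divff // cexp_neq0.
Qed.

Lemma cexp_sum (I : Type) (s : seq I) (f : I -> C) :
  cexp (\sum_(i <- s) f i) = \prod_(i <- s) cexp (f i).
Proof. by apply: (big_morph _ cexpD cexp0). Qed.

Lemma sin_eq0_pi (b : R) : sin b = 0 -> exists m : int, b = m%:~R * pi.
Proof.
have sinn n : sin (pi *+ n) = 0 :> R.
  by elim: n => [|n IH]; rewrite ?mulr0n ?sin0 // mulrSr sinDpi IH oppr0.
have sinz (m : int) : sin (m%:~R * pi) = 0 :> R.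
  case: m => n; first by rewrite mulr_natl sinn.
  by rewrite NegzE mulrNz mulNr sinN mulr_natl sinn oppr0.
move=> sb; pose m := Num.floor (b / pi); exists m.
have p0 := pi_gt0 R.
have c0 : 0 <= b - m%:~R * pi by rewrite subr_ge0 -ler_pdivlMr // ge_floor.
have c1 : b - m%:~R * pi < pi.
  rewrite ltrBlDr -[X in X + _]mul1r -mulrDl -ltr_pdivrMr //.
  by rewrite addrC -[1]/(1%:~R) -intrD floorD1_gt.
have sc : sin (b - m%:~R * pi) = 0 by rewrite sinB sb sinz mul0r mulr0 subrr.
apply/eqP; rewrite -subr_eq0 eq_le c0 andbT leNgt; apply/negP => c2.
by have := sin_gt0_pi (x := b - m%:~R * pi); rewrite c2 c1 sc ltxx => /(_ isT).
Qed.

(** Only [sin b = 0] is exploited and the sign of [cos b] is ignored, whence multiples of [pi]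
    rather than [2 pi]: the periods matter through their countability alone. *)
Lemma cexp_eq1 w : cexp w = 1 -> exists m : int, w = (0 +i* (m%:~R * pi))%C.
Proof.
case: w => a b /eqP; rewrite /cexp eq_complex /= !mul0r subr0 addr0.
move=> /andP[/eqP h1 /eqP h2].
have sb : sin b = 0 by move/eqP: h2; rewrite mulf_eq0 gt_eqF ?expR_gt0 //= => /eqP.
have cb : cos b ^+ 2 = 1 by have := cos2Dsin2 b; rewrite sb expr0n /= addr0.
have a0 : a = 0.
  apply: expR_inj; rewrite expR0; apply/eqP.
  rewrite -(@eqrXn2 _ 2%N) ?expR_ge0 // expr1n.
  by have := congr1 (fun x => x ^+ 2) h1; rewrite exprMn cb mulr1 expr1n => ->.
by have [m ->] := sin_eq0_pi sb; exists m; rewrite a0.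
Qed.

Lemma is_derive_littleo (f : R -> R) (x df : R) : is_derive x 1 f df ->
  forall e : R, 0 < e -> \forall h \near (0 : R), `|f (h + x) - f x - h * df| <= e * `|h|.
Proof.
move=> [dfx dfE] e e0; have := diff_locally ((derivable1_diffP f x).1 dfx).
move=> /eqaddoP /(_ e e0); apply: filterS => h; rewrite /= !fctE /=.
by rewrite deriv1E // derive1E dfE opprD addrA.
Qed.

Lemma cexp_littleo (e : R) : 0 < e ->
  \forall w \near (0 : C), nr (cexp w - 1 - w) <= e * nr w.
Proof.
(* The real and the imaginary part each contribute an error of at most [3 d nr w]. *)
move=> e0; pose d := Num.min 1 (e / 6).
have d0 : 0 < d by rewrite lt_min ltr01 divr_gt0.
have d1 : d <= 1 by rewrite ge_min lexx.
have d6 : d * 6 <= e by rewrite -ler_pdivlMr // ge_min lexx orbT.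
have /nbhs_normP[r1 /= r10 h1] := is_derive_littleo (is_derive_expR 0) d0.
have /nbhs_normP[r2 /= r20 h2] := is_derive_littleo (is_derive_cos 0) d0.
have /nbhs_normP[r3 /= r30 h3] := is_derive_littleo (is_derive_sin 0) d0.
apply/near_nrP; exists (Num.min (d / 2) (Num.min r1 (Num.min r2 r3))).
  by rewrite !lt_min divr_gt0 // r10 r20.
move=> w; rewrite subr0 !lt_min => /and4P[wd w1 w2 w3].
have [aw bw] := nr_ReIm w; have n0 := nr_ge0 w.
have := h1 (complex.Re w); rewrite /ball_ /= sub0r normrN => /(_ (le_lt_trans aw w1)).
have := h2 (complex.Im w); rewrite /ball_ /= sub0r normrN => /(_ (le_lt_trans bw w2)).
have := h3 (complex.Im w); rewrite /ball_ /= sub0r normrN => /(_ (le_lt_trans bw w3)).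
rewrite !addr0 expR0 cos0 sin0 !mulr1 oppr0 mulr0 !subr0.
move=> hs hc he; apply: (le_trans (nr_le_ReIm _)).
move: wd n0 aw bw hs hc he; rewrite /cexp.
case: w {w1 w2 w3} => a b /=; rewrite !mul0r !subr0 !addr0.
move: (nr _) => N wd n0 aw bw hs hc he.
set E := expR a in he *.
have hda : d * `|a| <= d * N by rewrite ler_wpM2l // ltW.
have hdb : d * `|b| <= d * N by rewrite ler_wpM2l // ltW.
have dN : d * N <= N by rewrite -[leRHS]mul1r ler_wpM2r.
have E1 : `|E - 1| <= d.
  rewrite -[E - 1](subrK a); apply: (le_trans (ler_normD _ _)); lra.
have E2 : `|E| <= 2.
  by rewrite -[E](subrK 1); apply: (le_trans (ler_normD _ _)); rewrite normr1; lra.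
have x1 : `|E * cos b - 1 - a| <= 3 * (d * N).
  have -> : E * cos b - 1 - a = (E - 1 - a) + E * (cos b - 1) by ring.
  apply: (le_trans (ler_normD _ _)); rewrite normrM.
  have : `|E| * `|cos b - 1| <= 2 * (d * N) by apply: ler_pM => //; lra.
  lra.
have x2 : `|E * sin b - b| <= 3 * (d * N).
  have -> : E * sin b - b = E * (sin b - b) + (E - 1) * b by ring.
  apply: (le_trans (ler_normD _ _)); rewrite !normrM.
  have : `|E| * `|sin b - b| <= 2 * (d * N) by apply: ler_pM => //; lra.
  have : `|E - 1| * `|b| <= d * N by apply: ler_pM.
  lra.
have : d * 6 * N <= e * N by rewrite ler_wpM2r.
lra.
Qed.

End ComplexExponential.

Section LocalLog.
Variable R : realType.
Local Notation C := R[i].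

Lemma complex_ball_compact (z : C) r : compact [set x : C | nr (x - z) <= r].
Proof.
apply: (subclosed_compact _ (@complex_box_compact R (nr z + r))).
  rewrite (_ : mkset _ = (fun x => nr (x - z)) @^-1` [set x : R | x <= r]) //.
  apply: preimage_closed; last exact: closed_le.
  by move=> w _; exact: nr_sub_continuous.
by move=> x /= xr; rewrite -[x](subrK z) addrC (le_trans (nrD _ _)) // lerD2l.
Qed.

(* The inverse of [cexp - 1] near 0, got from the contraction argument for
   [shift_map] at time 1. *)
Lemma local_log : exists (L : C -> C) (r : R), [/\ 0 < r,
  forall w, nr w < r -> cexp (L w) = 1 + w, L 0 = 0,
  forall w w', nr w < r -> nr w' < r -> nr (L w - L w') <= 2 * nr (w - w') &
  forall e, 0 < e -> \forall w \near (0 : C), nr (L w - w) <= e * nr w].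
Proof.
(* With precision 1/16 on a ball of radius at most 1/16, the two terms of [g x - g y] contribute 1/8
   each to the Lipschitz constant, within the 1/2 required. *)
have e16 : 0 < (16^-1 : R) by rewrite invr_gt0.
have /near_nrP[r1 r10 h1] := cexp_littleo e16.
pose r0 := Num.min (r1 / 2) 16^-1.
have r00 : 0 < r0 by rewrite lt_min e16 divr_gt0.
have r0r1 : r0 <= r1 / 2 by rewrite ge_min lexx.
have r016 : r0 <= 16^-1 by rewrite ge_min lexx orbT.
pose g (x : C) : C := x - (cexp x - 1).
have sE x : shift_map g 1 x = cexp x - 1 by rewrite /shift_map scale1r subKr.
have n1 : nr (1 : C) = 1 by rewrite nr.unlock normr1.
have gl : lip_ball setT g 0 r0 2^-1.
  split=> // x y.
  rewrite !subr0 => x0 y0.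
  have xy : nr (x - y - 0) < r1 by rewrite subr0; have := nrB x y; lra.
  have := h1 _ xy; have := h1 y; rewrite subr0 => /(_ _) hy hxy.
  have {}hy : nr (cexp y - 1 - y) <= 16^-1 * nr y by apply: hy; lra.
  have ey : nr (cexp y - 1) <= 8^-1.
    rewrite -[cexp y - 1](subrK y); apply: (le_trans (nrD _ _)); lra.
  have ey2 : nr (cexp y) <= 2.
    by rewrite -[cexp y](subrK 1); apply: (le_trans (nrD _ _)); rewrite n1; lra.
  (* Factoring out [cexp y] reduces the increment between any two points to the expansion of [cexp]
     at 0. *)
  have -> : g x - g y = - (cexp y * (cexp (x - y) - 1 - (x - y))) - (cexp y - 1) * (x - y).
    have cx : cexp x = cexp y * cexp (x - y) by rewrite -cexpD addrC subrK.
    by rewrite /g cx; ring.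
  apply: (le_trans (nrB _ _)); rewrite nrN (nrM (cexp y)) (nrM (cexp y - 1)).
  have a1 : nr (cexp y) * nr (cexp (x - y) - 1 - (x - y)) <= 2 * (16^-1 * nr (x - y)).
    by apply: ler_pM; rewrite ?nr_ge0.
  have a2 : nr (cexp y - 1) * nr (x - y) <= 8^-1 * nr (x - y).
    by rewrite ler_wpM2r ?nr_ge0.
  apply: (le_trans (lerD a1 a2)).
  by have := nr_ge0 (x - y); move: (nr (x - y)) => N; lra.
have tK : nr (1 : C) * 2^-1 <= 2^-1 by rewrite n1 mul1r.
have g0 : shift_map g 1 0 = 0 by rewrite sE cexp0 subrr.
have ex w : exists x, nr w < r0 / 4 -> nr x <= r0 / 2 /\ cexp x - 1 = w.
  have [wr|wr] := ltP (nr w) (r0 / 4); last by exists 0.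
  have [|||x xr xw] := @shift_map_solve _ _ complex_ball_compact setT g 0 r0 2^-1 1 w (r0 / 2) gl tK.
  - by rewrite divr_gt0.
  - lra.
  - by rewrite g0 subr0; lra.
  - by exists x => _; rewrite -sE; move: xr; rewrite subr0.
have [L LE] := choice ex.
have r4 : 0 < r0 / 4 by rewrite divr_gt0.
have lip w w' : nr w < r0 / 4 -> nr w' < r0 / 4 -> nr (L w - L w') <= 2 * nr (w - w').
  move=> wr wr'; have [a1 a2] := LE _ wr; have [b1 b2] := LE _ wr'.
  have := shift_map_expand gl tK (x := L w) (y := L w').
  by rewrite !sE a2 b2 !subr0; apply; lra.
have L0 : L 0 = 0.
  have nr00 : nr (0 : C) < r0 / 4 by rewrite nr0.
  have [a1 a2] := LE _ nr00.
  have := shift_map_expand gl tK (x := L 0) (y := 0).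
  rewrite sE a2 g0 subrr nr0 mulr0 !subr0 => /(_ _ r00) h.
  by apply/nr_eq0/eqP; rewrite eq_le nr_ge0 h //; lra.
exists L, (r0 / 4); split=> // [w wr|e e0].
  by have [_ wE] := LE _ wr; rewrite -[X in 1 + X]wE addrC subrK.
have e2 : 0 < e / 2 by rewrite divr_gt0.
have /near_nrP[d d0 hd] := cexp_littleo e2.
apply/near_nrP; exists (Num.min (r0 / 4) (d / 2)).
  by rewrite lt_min r4 divr_gt0.
move=> w; rewrite subr0 lt_min => /andP[wr wd].
have nr00 : nr (0 : C) < r0 / 4 by rewrite nr0.
have := lip _ _ wr nr00; rewrite L0 !subr0 => Lw.
have := hd (L w); rewrite subr0 => /(_ _); have [_ ->] := LE _ wr.
rewrite nrBC => h; apply: (le_trans (h _)); first by lra.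
have : e / 2 * nr (L w) <= e / 2 * (2 * nr w) by rewrite ler_wpM2l // ltW.
lra.
Qed.

(** If the end values differed, the intermediate value theorem would place the whole interval
    between them inside [Y], which has Lebesgue measure zero. *)
Lemma countable_valued_const (f : R -> R) (Y : set R) : countable Y ->
  {within `[0, 1], continuous f} -> (forall s, 0 <= s <= 1 -> Y (f s)) -> f 0 = f 1.
Proof.
move=> cY cf fY; apply/eqP/negPn/negP => f01.
pose a := Num.min (f 0) (f 1); pose b := Num.max (f 0) (f 1).
have ab : a < b.
  by rewrite /a /b; case: (ltgtP (f 0) (f 1)) f01 => // ->; rewrite eqxx.
have sub : `[a, b]%classic `<=` Y.
  move=> v /=; rewrite in_itv /= => vab.
  have [c] := IVT ler01 cf vab; rewrite in_itv /= => c01 <-.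
  exact: fY.
have := countable_lebesgue_measure0 (sub_countable (subset_card_le sub) cY).
rewrite lebesgue_measure_itv /= lte_fin ab => /eqP.
by rewrite -EFinB eqe subr_eq0 gt_eqF.
Qed.

Lemma countable_valued_ball (E : normedModType C) (f : E -> R) (Y : set R) z0 r :
  countable Y -> (forall x, nr (x - z0) < r -> Y (f x)) ->
  (forall x, nr (x - z0) < r -> {for x, continuous f}) ->
  forall z, nr (z - z0) < r -> f z = f z0.
Proof.
move=> cY fY cf z zr; have n0 := nr_ge0 (z - z0).
pose p (s : R) : E := z0 + (s%:C)%C *: (z - z0).
have pr s : 0 <= s <= 1 -> nr (p s - z0) < r.
  move=> /andP[s0 s1]; rewrite /p addrC addKr nrZ nr_real ger0_norm //.
  by apply: le_lt_trans zr; rewrite -[leRHS]mul1r ler_wpM2r.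
have cp : continuous p.
  move=> s; apply/cvg_nrP => e e0.
  have e1 : 0 < e / (nr (z - z0) + 1) by rewrite divr_gt0 // ltr_wpDl.
  have : \forall x \near s, ball s (e / (nr (z - z0) + 1)) x by exact: nbhsx_ballx.
  apply: filterS => x; rewrite /ball /= => xs.
  have -> : p x - p s = ((x - s)%:C)%C *: (z - z0).
    by rewrite /p opprD addrACA subrr add0r -scalerBl -rmorphB.
  rewrite nrZ nr_real distrC.
  apply: (@le_trans _ _ (`|s - x| * (nr (z - z0) + 1))); first by rewrite ler_wpM2l // lerDl.
  by rewrite -ler_pdivlMr ?ltW // ltr_wpDl.
have := @countable_valued_const (f \o p) Y cY.
rewrite /= /p scale0r addr0 scale1r [z0 + _]addrC subrK => -> //.
  apply: continuous_in_subspaceT => s; rewrite inE /= in_itv /= => s01.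
  by apply: (@continuous_comp _ _ _ p f s (cp s)); exact: cf (pr _ s01).
by move=> s s01; exact: fY (pr _ s01).
Qed.

End LocalLog.


Lemma nr_sum (R : realType) (V : normedModType R[i]) (I : Type) (s : seq I) (F : I -> V) :
  nr (\sum_(i <- s) F i) <= \sum_(i <- s) nr (F i).
Proof.
elim: s => [|i s IH]; first by rewrite !big_nil nr0.
by rewrite !big_cons (le_trans (nrD _ _)) // lerD2l.
Qed.

Lemma complex_Im_continuous (R : realType) : continuous (@complex.Im R).
Proof.
move=> w; apply/(@cvgrPdist_le R R R[i] (nbhs w) (nbhs_filter w)) => e e0.
have := near_nr_lt w e0; apply: filterS => y /ltW; apply: le_trans.
by rewrite distrC -raddfB; exact: (nr_ReIm _).2.
Qed.

(** * Differentiability of a continuous branch *)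

Section BranchDerivative.
Variables (R : realType) (n : nat) (A : finType).
Local Notation C := R[i].
Local Notation Cn := 'rV[C]_n.
Variables (u0 : A -> R) (u : A -> 'rV[R]_n) (lambda : A -> R).
Hypothesis lambda_gt0 : forall h, 0 < lambda h.

Definition normal (h : A) : Cn := \row_i (u h 0 i)%:C%C.

Definition log_gradient (z : Cn) : Cn :=
  \sum_h ((lambda h)%:C%C / affine_form u0 u h z) *: normal h.

Lemma nr_bilin_le (a v : Cn) : nr (bilin a v) <= (\sum_(i < n) nr (a 0 i)) * nr v.
Proof.
apply: (le_trans (nr_sum _ _)); rewrite mulr_suml; apply: ler_sum => i _.
by rewrite nrM ler_wpM2l ?nr_ge0 // nr_coord.
Qed.

Lemma affine_formB h z z0 :
  affine_form u0 u h z = affine_form u0 u h z0 + bilin (normal h) (z - z0).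
Proof.
rewrite /affine_form -addrA; congr (_ + _); rewrite -big_split.
by apply: eq_bigr => i _; rewrite !mxE /=; ring.
Qed.

(** The integer [mk.1] accounts for the ambiguity of the outer exponential, [mk.2] for the choice of
    a logarithm of each [f_h]. Steps of [pi] come from [cexp_eq1]; the set is only required to be
    countable. *)
Definition period_set : set R :=
  range (fun mk : int * {ffun A -> int} =>
    mk.1%:~R * pi + \sum_h lambda h * ((mk.2 h)%:~R * pi)).

Lemma period_set_countable : countable period_set.
Proof. exact: (sub_countable (card_image_le _ _) (countableP _)). Qed.

(* Two values of the multivalued logarithm differ by an element of the
   countable group [i period_set]. *)
Lemma log_values_period z w (l : A -> C) :
  (forall h, cexp (l h) = affine_form u0 u h z) -> log_master_values u0 u lambda z w ->
  complex.Re (w - \sum_h (lambda h)%:C%C * l h) = 0 /\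
  period_set (complex.Im (w - \sum_h (lambda h)%:C%C * l h)).
Proof.
move=> hl [l' [hl' hw]].
have ker h : exists m : int, l' h - l h = (0 +i* (m%:~R * pi))%C.
  by apply: cexp_eq1; rewrite cexpD cexpN hl hl' divff // -hl cexp_neq0.
have [k kE] := choice ker.
have [m mE] : exists m : int, w - \sum_h (lambda h)%:C%C * l' h = (0 +i* (m%:~R * pi))%C.
  apply: cexp_eq1; rewrite cexpD cexpN cexp_sum hw divff //.
  by rewrite -hw cexp_neq0.
have -> : w - \sum_h (lambda h)%:C%C * l h =
    (0 +i* (m%:~R * pi + \sum_h lambda h * ((k h)%:~R * pi)))%C.
  have -> : w - \sum_h (lambda h)%:C%C * l h =
     (w - \sum_h (lambda h)%:C%C * l' h) + \sum_h (lambda h)%:C%C * (l' h - l h).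
    have -> : \sum_h (lambda h)%:C%C * (l' h - l h) =
        \sum_h (lambda h)%:C%C * l' h - \sum_h (lambda h)%:C%C * l h.
      by rewrite -sumrB; apply: eq_bigr => h _; rewrite mulrBr.
    by rewrite addrA subrK.
  rewrite mE; under eq_bigr do rewrite kE.
  have -> : \sum_h (lambda h)%:C%C * (0 +i* ((k h)%:~R * pi))%C =
      (0 +i* (\sum_h lambda h * ((k h)%:~R * pi)))%C.
    elim/big_ind2 : _ => // [x1 x2 y1 y2 -> ->|h _]; first by simpc.
    by simpc.
  by simpc.
split=> //=; exists (m, finfun k) => //=.
by congr (_ + _); apply: eq_bigr => h _; rewrite ffunE.
Qed.

Variables (D : set Cn) (P : Cn -> C).
Hypothesis open_D : open D.
Hypothesis D_compl : D `<=` arr_complement u0 u.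
Hypothesis branch_P : log_master_branch u0 u lambda D P.

(** [P] is compared with the explicit local branch built from [L]. Their difference [d] is
    continuous, has zero real part and imaginary part in [period_set], hence is constant near [z0];
    what remains of the expansion is [L (om h z) - om h z], summed with weights [lambda h]. *)
Lemma branch_littleo z0 e : D z0 -> 0 < e ->
  \forall z \near z0,
    nr (P z - P z0 - bilin (log_gradient z0) (z - z0)) <= e * nr (z - z0).
Proof.
move=> Dz0 e0; have [L [r [r0 Lexp L0 Llip Lo]]] := local_log R.
pose c h := affine_form u0 u h z0.
have c0 h : c h != 0 by exact: D_compl.
have [l0 [hl0 _]] := branch_P.1 z0 Dz0.
(* Here [f_h(z) = f_h(z0) (1 + om h z)], so [l0 h + L (om h z)] is a continuous logarithm of [f_h]
   near [z0]. *)
pose om h z := bilin (normal h) (z - z0) / c h.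
pose K h := (\sum_(i < n) nr (normal h 0 i)) / nr (c h).
have K0 h : 0 <= K h.
  by rewrite /K divr_ge0 ?nr_ge0 // sumr_ge0 // => i _; exact: nr_ge0.
pose B := \sum_h K h.
have B0 : 0 <= B by rewrite sumr_ge0.
have KB h : K h <= B by rewrite /B (bigD1 h) //= lerDl sumr_ge0.
have omB h z z' : nr (om h z - om h z') <= B * nr (z - z').
  rewrite /om -mulrBl -bilinBr opprB addrA subrK nrM nrV.
  apply: (@le_trans _ _ (K h * nr (z - z'))); last by rewrite ler_wpM2r ?nr_ge0.
  by rewrite /K mulrAC ler_wpM2r ?invr_ge0 ?nr_ge0 // nr_bilin_le.
have om0 h : om h z0 = 0 by rewrite /om subrr bilin0r mul0r.
have omn h z : nr (om h z) <= B * nr (z - z0).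
  by have := omB h z z0; rewrite om0 subr0.
have B1 : 0 < B + 1 by rewrite ltr_wpDl.
have small (b : R) z : 0 < b -> nr (z - z0) < b / (B + 1) -> B * nr (z - z0) < b.
  move=> b0; rewrite ltr_pdivlMr // => h.
  apply: le_lt_trans h; rewrite mulrDr mulr1 mulrC lerDl; exact: nr_ge0.
have := open_D; rewrite openE => /(_ _ Dz0) /near_nrP[dD dD0 hD].
pose lh h z := l0 h + L (om h z).
pose d z := P z - \sum_h (lambda h)%:C%C * lh h z.
pose La := \sum_h lambda h.
have La0 : 0 <= La by rewrite sumr_ge0 // => h _; exact: ltW.
pose rr := Num.min dD (r / (B + 1)).
have rr0 : 0 < rr by rewrite lt_min dD0 divr_gt0.
have rD z : nr (z - z0) < rr -> D z by rewrite lt_min => /andP[/hD].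
have rom h z : nr (z - z0) < rr -> nr (om h z) < r.
  by rewrite lt_min => /andP[_ /(small _ _ r0)]; exact: le_lt_trans (omn h z).
have lhE h z : nr (z - z0) < rr -> cexp (lh h z) = affine_form u0 u h z.
  move=> zr; rewrite /lh cexpD hl0 (Lexp _ (rom h z zr)) (affine_formB h z z0).
  have h0 := c0 h; rewrite /om -/(c h).
  move: (c h) (bilin _ _) h0 => x y x0; by field.
have sumB (F : A -> C) (b : R) : (forall h, nr (F h) <= b) ->
    nr (\sum_h (lambda h)%:C%C * F h) <= La * b.
  move=> Fb; apply: (le_trans (nr_sum _ _)); rewrite mulr_suml; apply: ler_sum => h _.
  by rewrite nrM nr_real gtr0_norm // ler_wpM2l // ltW.
have dper z : nr (z - z0) < rr ->
    complex.Re (d z) = 0 /\ period_set (complex.Im (d z)).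
  move=> zr; apply: (@log_values_period z); last exact: branch_P.1 (rD _ zr).
  by move=> h; exact: lhE.
have dcont z : nr (z - z0) < rr -> {for z, continuous (fun x => complex.Im (d x))}.
  move=> zr; have cP := branch_P.2 _ (rD _ zr).
  suff cd : {for z, continuous d}.
    exact: (@continuous_comp _ _ _ d (@complex.Im R) z cd (@complex_Im_continuous R _)).
  apply/continuous_nrP => b b0; have b2 : 0 < b / 2 by rewrite divr_gt0.
  have n1 := (continuous_nrP _ _).1 cP _ b2.
  have M0 : 0 < La * (2 * B) + 1 by rewrite ltr_wpDl // !mulr_ge0.
  have n2 := near_nr_lt z (divr_gt0 b2 M0).
  have zr' : 0 < rr - nr (z - z0) by rewrite subr_gt0.
  have n3 := near_nr_lt z zr'.
  suff key x : nr (P x - P z) <= b / 2 -> nr (x - z) < b / 2 / (La * (2 * B) + 1) ->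
     nr (x - z) < rr - nr (z - z0) -> nr (d x - d z) <= b.
    by near=> x; apply: key; near: x.
  rewrite ltr_pdivlMr // => h1 h2 h3.
  have xr : nr (x - z0) < rr by have := nr_triangle x z z0; lra.
  have -> : d x - d z = (P x - P z) - \sum_h (lambda h)%:C%C * (L (om h x) - L (om h z)).
    rewrite /d subrBB -sumrB; congr (_ - _); apply: eq_bigr => h _.
    by rewrite /lh -mulrBr opprD addrACA subrr add0r.
  apply: (le_trans (nrB _ _)).
  have := sumB (fun h => L (om h x) - L (om h z)) (2 * (B * nr (x - z))).
  move=> /(_ _) h4.
  have {}h4 : nr (\sum_h (lambda h)%:C%C * (L (om h x) - L (om h z))) <= La * (2 * (B * nr (x - z))).
    apply: h4 => h; apply: (le_trans (Llip _ _ (rom h x xr) (rom h z zr))).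
    by rewrite ler_pM2l.
  have n0 := nr_ge0 (x - z).
  apply: (le_trans (lerD h1 h4)); move: h2 n0.
  by move: (nr (x - z)) => N; lra.
have dconst z : nr (z - z0) < rr -> d z = d z0.
  move=> zr.
  have zz : nr (z0 - z0) < rr by rewrite subrr nr0.
  have hIm := countable_valued_ball period_set_countable (fun x xr => (dper x xr).2) dcont zr.
  apply/eqP; rewrite eq_complex hIm eqxx andbT.
  by rewrite (dper z zr).1 (dper z0 zz).1.
(* The weights sum to [La] and each [om h z] is at most [B nr (z - z0)], so this relative precision
   for [L] adds up to at most [e]. *)
have e1 : 0 < e / (La * B + 1) by rewrite divr_gt0 // ltr_wpDl // mulr_ge0.
have /near_nrP[dl dl0 hdl] := Lo _ e1.
apply/near_nrP; exists (Num.min rr (dl / (B + 1))).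
  by rewrite lt_min rr0 divr_gt0.
move=> z; rewrite lt_min => /andP[zr /(small _ _ dl0) zl].
have -> : P z - P z0 - bilin (log_gradient z0) (z - z0) =
    \sum_h (lambda h)%:C%C * (L (om h z) - om h z).
  have := dconst z zr; rewrite /d => dE.
  have -> : P z = (P z - \sum_h (lambda h)%:C%C * lh h z) + \sum_h (lambda h)%:C%C * lh h z.
    by rewrite subrK.
  rewrite dE.
  have -> : bilin (log_gradient z0) (z - z0) = \sum_h (lambda h)%:C%C * om h z.
    rewrite bilinC /log_gradient.
    have -> : forall s : seq A, bilin (z - z0) (\sum_(h <- s)
        ((lambda h)%:C%C / affine_form u0 u h z0) *: normal h) =
        \sum_(h <- s) (lambda h)%:C%C * om h z.
      elim=> [|h s IH]; first by rewrite !big_nil bilin0r.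
      by rewrite !big_cons bilinDr IH bilinZr /om /c bilinC -mulrA [_^-1 * _]mulrC.
    by [].
  have -> (x a b o : C) : x - a + b - x - o = b - a - o by ring.
  rewrite -!sumrB.
  apply: eq_bigr => h _; rewrite /lh om0 L0 addr0; ring.
have := sumB (fun h => L (om h z) - om h z) (e / (La * B + 1) * (B * nr (z - z0))).
move=> h1; apply: (le_trans (h1 _)) => [h|].
  have := hdl (om h z); rewrite subr0 => /(_ (le_lt_trans (omn h z) zl)).
  move=> h2; apply: (le_trans h2); rewrite ler_wpM2l //; exact: ltW.
have n0 := nr_ge0 (z - z0).
have e2 : e / (La * B + 1) * (La * B + 1) = e.
  by rewrite divfK // gt_eqF // ltr_wpDl // mulr_ge0.
move: e1 e2 n0; move: (e / _) (nr (z - z0)) => q N q0 <- N0.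
have := mulr_ge0 (ltW q0) N0; lra.
Unshelve. all: by end_near.
Qed.

End BranchDerivative.


Lemma diff_seq_sum (R : realType) (V W : normedModType R[i]) (I : Type) (s : seq I)
    (F : I -> V -> W) x : (forall i, differentiable (F i) x) ->
  differentiable (fun z => \sum_(i <- s) F i z) x /\
  forall v, 'd (fun z => \sum_(i <- s) F i z) x v = \sum_(i <- s) 'd (F i) x v.
Proof.
move=> dF; elim: s => [|i s [IH1 IH2]].
  have -> : (fun z => \sum_(i <- [::]) F i z) = cst 0 by apply/funext => z; rewrite big_nil.
  split=> [|v]; first exact: (differentiable_cst 0 x).
  by rewrite big_nil; exact: (congr1 (fun k : V -> W => k v) (diff_cst 0 x)).
have -> : (fun z => \sum_(j <- i :: s) F j z) = F i + (fun z => \sum_(j <- s) F j z).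
  by apply/funext => z; rewrite big_cons.
split=> [|v]; first exact: (differentiableD (dF i) IH1).
rewrite big_cons -IH2.
exact: (congr1 (fun k : V -> W => k v) (diffD (dF i) IH1)).
Qed.

(** * Regularity of the field [log_gradient] *)

Section GradientField.
Variables (R : realType) (n : nat) (A : finType).
Local Notation C := R[i].
Local Notation Cn := 'rV[C]_n.
Variables (u0 : A -> R) (u : A -> 'rV[R]_n) (lambda : A -> R).
Local Notation f := (affine_form u0 u).
Local Notation g := (log_gradient u0 u lambda).
Let nv h : Cn := (lambda h)%:C%C *: normal u h.

Lemma affine_form_diff h z : differentiable (f h) z /\
  forall v, 'd (f h) z v = bilin (normal u h) v.
Proof.
pose b (v : Cn) : C := bilin (normal u h) v.
have bl : linear b by move=> a x y; rewrite /b bilinDr bilinZr.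
pose bL : {linear Cn -> C} := HB.pack b (GRing.isLinear.Build _ _ _ _ b bl).
have H : is_diff z (f h) bL.
  apply: diff_nrP.
    exact: (@linear_nr_continuous _ _ _ bL _ (@nr_bilin_le R n (normal u h))).
  move=> e e0; apply/near_nrP; exists 1 => // y _.
  have -> : f h y - f h z - bL (y - z) = 0.
    by rewrite (affine_formB u0 u h y z) /= /b; ring.
  rewrite nr0.
  by rewrite mulr_ge0 ?nr_ge0 // ltW.
split; first exact: (@ex_diff _ _ _ _ _ _ _ H).
by move=> v; exact: (congr1 (fun k : Cn -> C => k v) (@diff_val _ _ _ _ _ _ _ H)).
Qed.

Let inv h (z : Cn) : C := (f h z)^-1.

Lemma inv_form_diff h z : f h z != 0 -> differentiable (inv h) z /\
  forall v, 'd (inv h) z v = - (inv h z * inv h z) * bilin (normal u h) v.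
Proof.
move=> fz; have [df dfE] := affine_form_diff h z.
split; first exact: differentiableV.
move=> v.
have e := congr1 (fun k : Cn -> C => k v) (diffV df fz).
apply: (etrans e); apply: (etrans (congr1 ( *%R (- (f h z) ^- 2)) (dfE v))).
by rewrite /inv -invfM -expr2.
Qed.

Lemma log_gradientE z : g z = \sum_h inv h z *: nv h.
Proof. by apply: eq_bigr => h _; rewrite /nv scalerA mulrC. Qed.

(** The dependence on [z] is confined to the scalar [inv h z * inv h z] in front of a fixed vector,
    so the product rule makes ['d g z v] differentiable, and so continuous, in [z]. *)
Let dterm (v : Cn) h (z : Cn) : Cn :=
  (inv h z * inv h z) *: ((- bilin (normal u h) v) *: nv h).

Lemma log_gradient_diff z : arr_complement u0 u z -> differentiable g z /\
  forall v, 'd g z v = \sum_h dterm v h z.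
Proof.
move=> fz.
have dT h : differentiable (fun x => inv h x *: nv h) z.
  exact: differentiableZl (inv_form_diff (fz h)).1.
have [dS dSE] := diff_seq_sum (index_enum A) dT.
have -> : g = fun x => \sum_h inv h x *: nv h by apply/funext => x; exact: log_gradientE.
split=> // v; apply: (etrans (dSE v)); apply: eq_bigr => h _.
have [di diE] := inv_form_diff (fz h).
apply: (etrans (congr1 (fun k : Cn -> Cn => k v) (diffZl (nv h) di))).
apply: (etrans (congr1 (fun a : C => a *: nv h) (diE v))).
by rewrite /dterm [RHS]scalerA mulrN mulNr.
Qed.

Lemma log_gradient_C1 (D : set Cn) z v : open D -> D `<=` arr_complement u0 u -> D z ->
  {for z, continuous (fun x => 'd g x v)}.
Proof.
move=> oD hD Dz.
have dT h : differentiable (dterm v h) z.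
  apply: differentiableZl.
  have di := (inv_form_diff (hD _ Dz h)).1.
  exact: (differentiableM di di).
have [dS _] := diff_seq_sum (index_enum A) dT.
apply: near_eq_continuous (differentiable_continuous dS).
have : \forall x \near z, D x by move: oD; rewrite openE => /(_ _ Dz).
apply: filterS => x /hD Dx; exact: (log_gradient_diff Dx).2.
Qed.

(** The radius is chosen so that [f_h] keeps at least half of its modulus at [z]; the constant then
    comes from [1/a - 1/c = (c - a) / (a c)]. *)
Lemma inv_form_lipschitz h z : f h z != 0 -> exists r K : R, [/\ 0 < r, 0 <= K &
  forall x y, nr (x - z) < r -> nr (y - z) < r -> nr (inv h x - inv h y) <= K * nr (x - y)].
Proof.
move=> fz; pose b := \sum_(i < n) nr (normal u h 0 i).
have b0 : 0 <= b by rewrite sumr_ge0 // => i _; exact: nr_ge0.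
have fl x y : nr (f h x - f h y) <= b * nr (x - y).
  have -> : f h x - f h y = bilin (normal u h) (x - y).
    by rewrite (affine_formB u0 u h x y); ring.
  exact: nr_bilin_le.
have m0 : 0 < nr (f h z) by rewrite nr_gt0.
have b1 : 0 < b + 1 by rewrite ltr_wpDl.
exists (nr (f h z) / 2 / (b + 1)), (b * (2 / nr (f h z)) ^+ 2); split.
- by rewrite !divr_gt0.
- by rewrite mulr_ge0 // sqr_ge0.
have big x : nr (x - z) < nr (f h z) / 2 / (b + 1) -> nr (f h z) / 2 <= nr (f h x).
  rewrite ltr_pdivlMr // => xz; have := nr_triangle (f h z) (f h x) 0.
  rewrite !subr0 nrBC; have := fl x z; have := nr_ge0 (x - z).
  move: xz; move: (nr (x - z)) (nr (f h x - f h z)) (nr (f h x)) (nr (f h z)) => p q s t; lra.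
move=> x y /big fx /big fy.
have m2 : 0 < nr (f h z) / 2 by rewrite divr_gt0.
have fx0 : f h x != 0 by rewrite -nr_gt0 (lt_le_trans m2).
have fy0 : f h y != 0 by rewrite -nr_gt0 (lt_le_trans m2).
have -> : inv h x - inv h y = (f h y - f h x) * (inv h x * inv h y).
  rewrite /inv; move: (f h x) (f h y) fx0 fy0 => a c a0 c0; by field; rewrite a0 c0.
have inv_le w : nr (f h z) / 2 <= nr (f h w) -> nr (inv h w) <= 2 / nr (f h z).
  by move=> fw; rewrite nrV -[leRHS]invf_div lef_pV2 // posrE // (lt_le_trans m2).
rewrite !nrM nrBC [leRHS]mulrAC expr2.
by rewrite ler_pM ?mulr_ge0 ?nr_ge0 ?fl // ler_pM ?nr_ge0 ?inv_le.
Qed.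

Lemma log_gradient_lipschitz (D : set Cn) z : open D -> D `<=` arr_complement u0 u ->
  D z -> exists r K, lip_ball D g z r K.
Proof.
move=> oD hD Dz.
have sumL (s : seq A) : exists r K : R, [/\ 0 < r, 0 <= K &
    forall x y, nr (x - z) < r -> nr (y - z) < r ->
      nr (\sum_(h <- s) inv h x *: nv h - \sum_(h <- s) inv h y *: nv h) <= K * nr (x - y)].
  elim: s => [|h s [r [K [r0 K0 hr]]]].
    by exists 1, 0; split=> // x y _ _; rewrite !big_nil subrr nr0 mul0r.
  have [r' [K' [r'0 K'0 hr']]] := inv_form_lipschitz (hD _ Dz h).
  exists (Num.min r r'), (K' * nr (nv h) + K); split.
  - by rewrite lt_min r0.
  - by rewrite addr_ge0 // mulr_ge0 ?nr_ge0.
  move=> x y; rewrite !lt_min => /andP[x1 x2] /andP[y1 y2].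
  rewrite !big_cons opprD addrACA -scalerBl mulrDl.
  apply: (le_trans (nrD _ _)); apply: lerD; last exact: hr.
  by rewrite nrZ mulrAC ler_wpM2r ?nr_ge0 // hr'.
have [r [K [r0 K0 hr]]] := sumL (index_enum A).
have := oD; rewrite openE => /(_ _ Dz) /near_nrP[d d0 hd].
exists (Num.min r d), K; split=> //; first by rewrite lt_min r0.
  by move=> x; rewrite lt_min => /andP[_ /hd].
move=> x y; rewrite !lt_min => /andP[x1 _] /andP[y1 _].
by rewrite !log_gradientE; exact: hr.
Qed.

End GradientField.

Lemma branch_diff (R : realType) (n : nat) (A : finType)
    (u0 : A -> R) (u : A -> 'rV[R]_n) (lambda : A -> R)
    (D : set 'rV[R[i]]_n) (P : 'rV[R[i]]_n -> R[i]) :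
  (forall h, 0 < lambda h) -> open D -> D `<=` arr_complement u0 u ->
  log_master_branch u0 u lambda D P -> forall z, D z ->
  differentiable P z /\ forall v, 'd P z v = bilin (log_gradient u0 u lambda z) v.
Proof.
move=> hl oD hD hP z Dz; set a := log_gradient u0 u lambda z.
pose b (v : 'rV[R[i]]_n) : R[i] := bilin a v.
have bl : linear b by move=> k x y; rewrite /b bilinDr bilinZr.
pose bL : {linear 'rV[R[i]]_n -> R[i]} := HB.pack b (GRing.isLinear.Build _ _ _ _ b bl).
have H : is_diff z P bL.
  apply: diff_nrP; first exact: (@linear_nr_continuous _ _ _ bL _ (@nr_bilin_le R n a)).
  by move=> e e0; exact: (branch_littleo hl oD hD hP Dz e0).
split; first exact: (@ex_diff _ _ _ _ _ _ _ H).
by move=> v; exact: (congr1 (fun k : 'rV[R[i]]_n -> R[i] => k v) (@diff_val _ _ _ _ _ _ _ H)).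
Qed.

(** * Uniqueness for the Hamilton-Jacobi equation *)

Section Uniqueness.
Variables (R : realType) (n : nat).
Local Notation C := R[i].
Local Notation Cn := 'rV[C]_n.
Let unc (q : C -> Cn -> C) (p : C * Cn) : C := q p.1 p.2.

(** The partial derivatives are differentiable by [holo2], hence continuous, and stay within 1 of
    their values at [p0]. The bound supplies the slope of the cone in [transport_unique]. *)
Lemma grad_bounded (W : set (C * Cn)) (q : C -> Cn -> C) p0 : holo2 W (unc q) -> W p0 ->
  exists2 M : R, 0 <= M & \forall p \near p0, nr (grad (q p.1) p.2) <= M.
Proof.
move=> hq Wp; pose dq i := 'D_((0 : C, delta_mx 0 i : Cn)) (unc q).
have cd i : \forall p \near p0, nr (dq i p - dq i p0) <= 1.
  have [_ /(_ (0, delta_mx 0 i)) [/differentiable_continuous cq _]] := hq _ Wp.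
  exact: ((continuous_nrP _ _).1 cq _ ltr01).
pose M := \sum_i nr (dq i p0) + 1.
have S0 : 0 <= \sum_i nr (dq i p0) by rewrite sumr_ge0 // => i _; exact: nr_ge0.
have M0 : 0 <= M by rewrite addr_ge0.
exists M => //; have := filter_forall (nbhs_filter p0) cd; apply: filterS => p hp.
apply: nr_rV_le => // i; rewrite mxE.
have -> : 'D_(delta_mx 0 i) (q p.1) p.2 = dq i p.
  by apply: (etrans (derive_slice _ _ _ _)); case: (p).
apply: (@le_trans _ _ (nr (dq i p0) + 1)).
  by rewrite -[dq i p](subrK (dq i p0)) addrC (le_trans (nrD _ _)) // lerD2l.
rewrite lerD2r (bigD1 i) //= lerDl sumr_ge0 // => j _; exact: nr_ge0.
Qed.

(* [b] is arbitrary here; for two solutions, the mean of their gradients makes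
   the right-hand sides agree, by [transport_cancel]. *)
Lemma diff_HJ (q : C -> Cn -> C) (p : C * Cn) (b : Cn) :
  differentiable (unc q) p ->
  derive1 (fun s => q s p.2) p.1 = 2^-1 * bilin (grad (q p.1) p.2) (grad (q p.1) p.2) ->
  'd (unc q) p (-1, b) = bilin b (grad (q p.1) p.2)
    - 2^-1 * bilin (grad (q p.1) p.2) (grad (q p.1) p.2).
Proof.
move=> dq; have pE : p = (p.1, p.2) by case: (p).
have tE : derive1 (fun s => q s p.2) p.1 = 'd (unc q) p (1, 0).
  by apply: (etrans (derive1_slice _ _ _)); rewrite -pE; exact: deriveE.
rewrite tE => <-.
have xE i : grad (q p.1) p.2 0 i = 'd (unc q) p (0, delta_mx 0 i).
  by rewrite mxE; apply: (etrans (derive_slice _ _ _ _)); rewrite -pE; exact: deriveE.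
have bE : 'd (unc q) p (0, b) = bilin b (grad (q p.1) p.2).
  have -> : ((0, b) : C * Cn) = \sum_i b 0 i *: ((0, delta_mx 0 i) : C * Cn).
    rewrite {1}[b]row_sum_delta.
    elim/big_rec2 : _ => // i x y _ <-; congr pair => /=; by rewrite scaler0 add0r.
  by rewrite linear_sum; apply: eq_bigr => i _; rewrite linearZ /= xE.
rewrite -bE -linearB /=; congr ('d _ _ _).
by congr pair; rewrite /= ?sub0r ?subr0.
Qed.

(** Difference of squares: [<(x + y)/2, x - y> = (<x, x> - <y, y>)/2], which turns the quadratic
    equation into a linear one for the difference of two solutions. *)
Lemma transport_cancel (x y : Cn) :
  bilin (2^-1 *: (x + y)) x - 2^-1 * bilin x x -
  (bilin (2^-1 *: (x + y)) y - 2^-1 * bilin y y) = 0.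
Proof.
rewrite !(bilinC (2^-1 *: _)) !bilinZr !bilinDr (bilinC y x).
by move: (bilin x x) (bilin x y) (bilin y y) => a b c; field.
Qed.

(** The two solutions have unrelated domains, so they are compared only near each point of the
    initial slice, where both gradients are bounded; [M' + M] then bounds the mean gradient. *)
Lemma HJ_unique (D : set Cn) P W W' (Q Q' : C -> Cn -> C) : open D ->
  slice_nbhd D W -> HJ_solution D P W Q ->
  slice_nbhd D W' -> HJ_solution D P W' Q' ->
  forall z, D z -> \forall p \near (0 : C, z), Q' p.1 p.2 = Q p.1 p.2.
Proof.
move=> oD [oW DW] [hQ eQ iQ] [oW' DW'] [hQ' eQ' iQ'] z Dz.
have nW : \forall p \near (0 : C, z), W p by move: oW; rewrite openE; apply; exact: DW.
have nW' : \forall p \near (0 : C, z), W' p by move: oW'; rewrite openE; apply; exact: DW'.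
have nD : \forall x \near z, D x by move: oD; rewrite openE; apply.
have [M M0 nM] := grad_bounded hQ (DW _ Dz).
have [M' M'0 nM'] := grad_bounded hQ' (DW' _ Dz).
pose S := unc Q' - unc Q.
suff : \forall p \near (0 : C, z), S p = 0.
  by apply: filterS => p /eqP; rewrite subr_eq0 => /eqP.
apply: (transport_unique (@closed_ball_compact R n) (addr_ge0 M'0 M0)).
- move: nW nW'; apply: filterS2 => p Wp Wp'.
  exact: (differentiableB (hQ' _ Wp').1 (hQ _ Wp).1).
- suff key p : W p -> W' p -> nr (grad (Q p.1) p.2) <= M -> nr (grad (Q' p.1) p.2) <= M' ->
    exists2 b : Cn, nr b <= M' + M & 'd S p (-1, b) = 0.
    by near=> p; apply: key; near: p.
  move=> Wp Wp' hM hM'; set a := grad (Q p.1) p.2 in hM *; set a' := grad (Q' p.1) p.2 in hM' *.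
  exists (2^-1 *: (a' + a)).
    rewrite nrZ nrV.
    have -> : nr (2 : C) = 2 by rewrite -[2 : C](rmorph_nat (real_complex R)) nr_real normr_nat.
    have h := le_trans (nrD a' a) (lerD hM' hM).
    have half0 : (0 : R) <= 2^-1 by rewrite invr_ge0.
    apply: (le_trans (ler_wpM2l half0 h)); move: M'0 M0; clear; lra.
  have dQ := (hQ _ Wp).1; have dQ' := (hQ' _ Wp').1.
  have eQp : derive1 (fun s => Q s p.2) p.1 = 2^-1 * bilin a a by apply: eQ; case: (p) Wp.
  have eQp' : derive1 (fun s => Q' s p.2) p.1 = 2^-1 * bilin a' a' by apply: eQ'; case: (p) Wp'.
  apply: (etrans (congr1 (fun k : C * Cn -> C => k (-1, 2^-1 *: (a' + a))) (diffB dQ' dQ))).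
  apply: (etrans (congr2 (fun x y => x - y)
    (diff_HJ (2^-1 *: (a' + a)) dQ' eQp') (diff_HJ (2^-1 *: (a' + a)) dQ eQp))).
  exact: transport_cancel.
- move: nD; apply: filterS => x Dx.
  by rewrite /S /unc !fctE /= (iQ _ Dx) (iQ' _ Dx) subrr.
Unshelve. all: by end_near.
Qed.

End Uniqueness.

Theorem theorem3p1 (R : realType) (n : nat) (A : finType)
    (u0 : A -> R) (u : A -> 'rV[R]_n) (lambda : A -> R)
    (hu : forall h, u h != 0) (hlambda : forall h, 0 < lambda h)
    (D : set 'rV[R[i]]_n) (P : 'rV[R[i]]_n -> R[i])
    (hDo : open D) (hDc : D `<=` arr_complement u0 u)
    (hP : log_master_branch u0 u lambda D P) :
  exists (W : set (R[i] * 'rV[R[i]]_n)) (Q : R[i] -> 'rV[R[i]]_n -> R[i]),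
    [/\ slice_nbhd D W,
        HJ_solution D P W Q,
        forall W' Q', slice_nbhd D W' -> HJ_solution D P W' Q' ->
          forall z, D z -> \forall p \near (0 : R[i], z), Q' p.1 p.2 = Q p.1 p.2
      & exists U : set (R[i] * 'rV[R[i]]_n),
          [/\ slice_nbhd D U,
              U `<=` [set p | D p.2]
            & slicewise_inverse U W (deformF P) (deformG Q)]].
Proof.
pose g := log_gradient u0 u lambda.
have lip_g z : D z -> exists r K, lip_ball D g z r K.
  exact: log_gradient_lipschitz.
have diff_g z : D z -> differentiable g z.
  by move=> Dz; exact: (log_gradient_diff lambda (hDc z Dz)).1.
have dg_cont z v : D z -> {for z, continuous (fun x => 'd g x v)}.
  exact: log_gradient_C1.
have dP z : D z -> differentiable P z /\ forall v, 'd P z v = bilin (g z) v.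
  exact: (branch_diff hlambda hDo hDc hP).
have solves := hj_sol_solution lip_g diff_g dg_cont
  (fun z Dz => (dP z Dz).1) (fun z v Dz => (dP z Dz).2 v).
have W_slice := shift_img_slice lip_g.
exists (shift_img D g), (hj_sol D P g); split=> //.
  by move=> W' Q' W'_slice solves'; exact: (HJ_unique hDo W_slice solves W'_slice solves').
exists (shift_dom D g); split; first exact: shift_dom_slice.
  by move=> [t z] [r [K [/lip_ball_center]]].
apply: hj_sol_inverse => //.
- by move=> z /dP[].
- by move=> z v /dP[].
move=> t z Dz; rewrite /deformF /shift_map; congr (_ - _ *: _).
apply/rowP => i; rewrite mxE; have [dPz dPE] := dP z Dz.
by apply: (etrans (deriveE _ dPz)); rewrite dPE bilin_delta.
Qed.
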